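(* Recursive isomorphism on $3^\omega$ is a universal countable Borel equivalence relation.
   Context: Recursive isomorphism on $Y^\omega$ is the orbit equivalence relation of the permutation action $(g\cdot y)(n)=y(g^{-1}(n))$ of the group of computable bijections $g\colon\omega\to\omega$ on $Y^\omega$; here $Y=3=\{0,1,2\}$. A countable Borel equivalence relation is a Borel equivalence relation on a standard Borel space all of whose classes are countable. Such an $E$ is universal if for every countable Borel equivalence relation $F$ there is a Borel reduction from $F$ to $E$, i.e. a Borel function $f$ with $x\mathrel{F}y\iff f(x)\mathrel{E}f(y)$. *)

(* Defs.v *)
From HB Require Import structures.
From mathcomp Require Import all_boot all_order all_algebra.
From mathcomp Require Import all_classical all_reals all_analysis.

Set Implicit Arguments.
Unset Strict Implicit.
Unset Printing Implicit Defensive.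

Local Open Scope classical_set_scope.
Local Open Scope nat_scope.

(* The class of (total) recursive functions: the least class containing the
   initial functions and closed under composition, primitive recursion and
   minimization of regular functions (those f with a zero f (y, v) = 0 for
   every v). *)
Inductive recursive : forall n : nat, (n.-tuple nat -> nat) -> Prop :=
| recursive_zero n : recursive (fun _ : n.-tuple nat => 0)
| recursive_succ : recursive (fun v : 1.-tuple nat => (thead v).+1)
| recursive_proj n (i : 'I_n) : recursive (fun v : n.-tuple nat => tnth v i)
| recursive_comp m n (f : m.-tuple nat -> nat)
    (g : 'I_m -> n.-tuple nat -> nat) (h : n.-tuple nat -> nat) :
    recursive f -> (forall i, recursive (g i)) ->
    (forall v, h v = f [tuple g i v | i < m]) ->
    recursive h
| recursive_prec n (f : n.-tuple nat -> nat) (g : n.+2.-tuple nat -> nat)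
    (h : n.+1.-tuple nat -> nat) :
    recursive f -> recursive g ->
    (forall v : n.-tuple nat, h [tuple of 0 :: v] = f v) ->
    (forall k (v : n.-tuple nat),
        h [tuple of k.+1 :: v] = g [tuple of k :: h [tuple of k :: v] :: v]) ->
    recursive h
| recursive_mu n (f : n.+1.-tuple nat -> nat) (h : n.-tuple nat -> nat) :
    recursive f ->
    (forall v : n.-tuple nat, f [tuple of h v :: v] = 0) ->
    (forall (v : n.-tuple nat) y, y < h v -> f [tuple of y :: v] <> 0) ->
    recursive h.

Definition computable (f : nat -> nat) : Prop :=
  recursive (fun v : 1.-tuple nat => f (thead v)).

(* [x] and [y] lie in the same orbit: y = g . x, where h is the inverse of g. *)
Definition recursively_isomorphic (Y : Type) (x y : nat -> Y) : Prop :=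
  exists g h : nat -> nat,
    [/\ computable g, cancel g h, cancel h g & forall n, y n = x (h n)].

Definition separable (T : topologicalType) : Prop :=
  exists2 D : set T, countable D & dense D.

Definition complete_metric (R : realType) (M : metricType R) : Prop :=
  forall u : nat -> M, cauchy (u @ \oo) -> exists x : M, u @ \oo --> x.

(* Isomorphic to the Borel space of a Polish space.  [measurableType]s are
   pointed, hence nonempty. *)
Definition standard_borel (R : realType) d (X : measurableType d) : Prop :=
  exists (M : metricType R) (f : X -> M),
    [/\ separable M, complete_metric M, bijective f &
        forall A : set X, measurable A <-> <<s @open M >> (f @` A)].

Record countable_borel_equivalence (R : realType) d (X : measurableType d)
    (E : X -> X -> Prop) : Prop := {
  cbe_standard : standard_borel R X ;
  cbe_equivalence : RelationClasses.Equivalence E ;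
  cbe_borel : measurable [set p : X * X | E p.1 p.2] ;
  cbe_countable : forall x, countable [set y | E x y] }.

Definition borel_reducible d d' (Y : measurableType d) (X : measurableType d')
    (F : Y -> Y -> Prop) (E : X -> X -> Prop) : Prop :=
  exists2 f : Y -> X, measurable_fun setT f &
    forall x y, F x y <-> E (f x) (f y).

Definition universal_countable_borel_equivalence (R : realType)
    d (X : measurableType d) (E : X -> X -> Prop) : Prop :=
  countable_borel_equivalence R E /\
  forall d' (Y : measurableType d') (F : Y -> Y -> Prop),
    countable_borel_equivalence R F -> borel_reducible F E.

Definition three_omega : Type := {ptws nat -> discrete_topology 'I_3}.
HB.instance Definition _ := Topological.on three_omega.
HB.instance Definition _ := isPointed.Build three_omega (fun=> ord0).

Definition borel_three_omega := g_sigma_algebraType (@open three_omega).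
HB.instance Definition _ := Measurable.on borel_three_omega.

(* Main.v *)
From HB Require Import structures.
Require Import Defs.
From mathcomp Require Import all_boot all_order all_algebra.
From mathcomp Require Import all_classical all_reals all_analysis.
From mathcomp Require Import ring lra.

(* Let F be a countable Borel equivalence relation on Y. By the Lusin-Novikov and
   Feldman-Moore theorems, F is generated by countably many Borel involutions, so
   it is the orbit equivalence relation of a free product of groups of order two.
   Spread every y over the positions x of omega, which are pairs of a group
   element a_x and a column, by f(y)(x) = c_(column of x)(a_x y), where the Borel
   functions c_j : Y -> 3 are still to be chosen. For every choice, F-related
   points have recursively isomorphic images, since the generators act on the
   positions by computable permutations preserving the columns.

   For the converse, the c_j are chosen in stages, one for each computable
   permutation g, infinitely many columns being left free at each stage. Stage n
   ensures that f(y') = f(y) o g implies y' F y. If g moves a position of a free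
   column to another free column, these two columns are made constant with
   distinct values; if g and its inverse move positions of free columns to columns
   already chosen, two free columns are chosen so as to copy and to contradict
   them. Otherwise g fixes infinitely many free columns, and they can hold an
   encoding of the points of Y, protected against g by a Borel 3-colouring d for
   which d(h v) differs from d(v) + s(v), h being the first map that moves v in
   a given sequence of Borel automorphisms. *)

Set Implicit Arguments.
Unset Strict Implicit.
Unset Printing Implicit Defensive.

Import Order.TTheory GRing.Theory Num.Theory.

Local Open Scope classical_set_scope.
Local Open Scope nat_scope.

(** * Recursive functions *)

Lemma eq_recursive n (f h : n.-tuple nat -> nat) :
  recursive f -> f =1 h -> recursive h.
Proof. by move=> rf /funext <-. Qed.

Definition recursive2 (f : nat -> nat -> nat) : Prop :=
  recursive (fun v : 2.-tuple nat => f (thead v) (thead (behead_tuple v))).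

Lemma recursive_comp1 n (f : nat -> nat) (g : n.-tuple nat -> nat) :
  computable f -> recursive g -> recursive (fun v => f (g v)).
Proof.
move=> rf rg; apply: (recursive_comp (g := fun _ : 'I_1 => g) rf) => // v.
by rewrite /thead tnth_mktuple.
Qed.

Lemma recursive_comp2 n (f : nat -> nat -> nat) (g h : n.-tuple nat -> nat) :
  recursive2 f -> recursive g -> recursive h ->
  recursive (fun v => f (g v) (h v)).
Proof.
move=> rf rg rh.
apply: (recursive_comp
  (g := fun i : 'I_2 => if i == ord0 then g else h) rf) => [i|v].
  by case: ifP.
rewrite /thead tnth_mktuple eqxx; congr f.
by rewrite [RHS](tnth_nth 0) [RHS]nth_behead -(tnth_nth 0 _ (lift ord0 ord0))
  tnth_mktuple.
Qed.

Lemma computable_id : computable id.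
Proof. exact: (@recursive_proj 1 ord0). Qed.

Lemma recursive_fst : recursive2 (fun x _ => x).
Proof. exact: (@recursive_proj 2 ord0). Qed.

Lemma recursive_snd : recursive2 (fun _ y => y).
Proof.
apply: eq_recursive (@recursive_proj 2 (lift ord0 ord0)) _ => v.
by rewrite /thead !(tnth_nth 0) /= nth_behead.
Qed.

Lemma computable_succ : computable succn.
Proof. exact: recursive_succ. Qed.

Lemma recursive_cst n k : recursive (fun _ : n.-tuple nat => k).
Proof.
elim: k => [|k ih]; first exact: recursive_zero.
exact: (recursive_comp1 computable_succ ih).
Qed.

Lemma recursive2_prec (b : nat -> nat) (g : nat -> nat -> nat)
    (h : nat -> nat -> nat) :
  computable b -> recursive2 g -> h 0 =1 b ->
  (forall k x, h k.+1 x = g (h k x) x) -> recursive2 h.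
Proof.
move=> rb rg h0 hS.
pose g' (v : 3.-tuple nat) := g (tnth v (lift ord0 ord0)) (tnth v ord_max).
have rg' : recursive g'.
  by apply: (@recursive_comp2 3 g) => //; exact: recursive_proj.
apply: (@recursive_prec 1 _ g' _ rb rg') => [v|k v].
  rewrite /= -h0 /thead !(tnth_nth 0) /=.
  by rewrite -[RHS]/(h 0 (nth 0 v 0)); case: v => -[].
rewrite /g' /thead !(tnth_nth 0) /= -hS.
by rewrite -[LHS]/(h k.+1 (nth 0 v 0)); case: v => -[].
Qed.

Lemma recursive2_prec_index (b : nat -> nat) (g : nat -> nat -> nat)
    (h : nat -> nat -> nat) :
  computable b -> recursive2 g -> h 0 =1 b ->
  (forall k x, h k.+1 x = g k x) -> recursive2 h.
Proof.
move=> rb rg h0 hS.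
pose g' (v : 3.-tuple nat) := g (tnth v ord0) (tnth v ord_max).
have rg' : recursive g'.
  by apply: (@recursive_comp2 3 g) => //; exact: recursive_proj.
apply: (@recursive_prec 1 _ g' _ rb rg') => [v|k v].
  rewrite /= -h0 /thead !(tnth_nth 0) /=.
  by rewrite -[RHS]/(h 0 (nth 0 v 0)); case: v => -[].
rewrite /g' /thead !(tnth_nth 0) /= -hS.
by rewrite -[LHS]/(h k.+1 (nth 0 v 0)); case: v => -[].
Qed.

Lemma recursive2_swap f : recursive2 f -> recursive2 (fun x y => f y x).
Proof.
by move=> rf; exact: (recursive_comp2 rf recursive_snd recursive_fst).
Qed.

Lemma recursive_add : recursive2 addn.
Proof.
apply: (@recursive2_prec id (fun x _ => x.+1)) => //.
- exact: computable_id.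
- exact: (recursive_comp1 computable_succ recursive_fst).
Qed.

Lemma recursive_mul : recursive2 muln.
Proof.
apply: (@recursive2_prec (fun=> 0) addn) => //.
- exact: recursive_zero.
- exact: recursive_add.
- by move=> k x; rewrite mulSn addnC.
Qed.

Lemma computable_pred : computable predn.
Proof.
have rp : recursive2 (fun k _ => k.-1).
  apply: (@recursive2_prec_index (fun=> 0) (fun k _ => k)) => //.
  - exact: recursive_zero.
  - exact: recursive_fst.
exact: (recursive_comp2 rp computable_id computable_id).
Qed.

Lemma recursive_sub : recursive2 subn.
Proof.
apply: (@recursive2_swap (fun k x => x - k)).
apply: (@recursive2_prec id (fun x _ => x.-1)).
- exact: computable_id.
- exact: (recursive_comp1 computable_pred recursive_fst).
- by move=> x; rewrite subn0.
- by move=> k x; rewrite subnS.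
Qed.

Lemma recursive2_mu f h : recursive2 f -> (forall x, f (h x) x = 0) ->
  (forall x y, y < h x -> f y x <> 0) -> computable h.
Proof.
move=> rf h0 hmin; apply: (@recursive_mu 1 _ (fun v => h (thead v)) rf).
  move=> v; rewrite -[RHS](h0 (thead v)) /thead !(tnth_nth 0) /=.
  by case: v => -[].
move=> v y /hmin; rewrite /thead !(tnth_nth 0) /=.
by case: v => -[].
Qed.

Lemma computable_comp f g : computable f -> computable g ->
  computable (f \o g).
Proof. exact: recursive_comp1. Qed.

(** Unbounded search finds the inverse: the two truncated differences add up to [|g y - x|], whose
    only zero is [y = h x]. *)
Lemma computable_inv g h : computable g -> cancel g h -> cancel h g ->
  computable h.
Proof.
move=> rg gh hg.
pose f y x := (g y - x) + (x - g y).
have rgy : recursive2 (fun y _ => g y) := recursive_comp1 rg recursive_fst.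
have rf : recursive2 f.
  by apply: (recursive_comp2 recursive_add);
    apply: (recursive_comp2 recursive_sub) => //; exact: recursive_snd.
apply: (recursive2_mu rf) => [x|x y]; first by rewrite /f hg subnn.
move=> yhx; rewrite /f => /eqP; rewrite addn_eq0 !subn_eq0 -eqn_leq => /eqP gyx.
by move: yhx; rewrite -gyx gh ltnn.
Qed.

Lemma computable_divn M : 0 < M -> computable (divn^~ M).
Proof.
(* [f q x] vanishes iff [x < M * (q + 1)], and the quotient is the least such [q]. *)
move=> M0; pose f q x := x.+1 - M * q.+1.
apply: (@recursive2_mu f) => [|x|x y].
- apply: (recursive_comp2 recursive_sub).
    exact: (recursive_comp1 computable_succ recursive_snd).
  apply: (recursive_comp2 recursive_mul); first exact: recursive_cst.
  exact: (recursive_comp1 computable_succ recursive_fst).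
- by apply/eqP; rewrite subn_eq0 mulnC ltn_ceil.
- rewrite /f => yx /eqP; rewrite subn_eq0; apply/negP; rewrite -ltnNge.
  by rewrite ltnS mulnC -leq_divRL.
Qed.

Lemma computable_modn M : 0 < M -> computable (modn^~ M).
Proof.
move=> M0.
suff : computable (fun x => x - M * (x %/ M)).
  move=> /eq_recursive; apply => v.
  by rewrite {1}(divn_eq (thead v) M) mulnC addKn.
apply: (recursive_comp2 recursive_sub); first exact: computable_id.
apply: (recursive_comp2 recursive_mul); first exact: recursive_cst.
exact: computable_divn.
Qed.

(** * Countability of the recursive functions *)

Section countability.

Let tree := GenTree.tree nat.

(* [Node 2] codes a composition, whose inner functions form a list coded with
   [Node 5] and indexed by [i]; [Node 3] and [Node 4] code primitive recursion
   and minimization. *)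
Fixpoint eval (t : tree) (i : nat) (v : seq nat) {struct t} : nat :=
  match t with
  | GenTree.Leaf k => nth 0 v k
  | GenTree.Node 0 _ => 0
  | GenTree.Node 1 _ => (nth 0 v 0).+1
  | GenTree.Node 2 [:: GenTree.Leaf m; f; g] =>
      eval f 0 [seq eval g j v | j <- iota 0 m]
  | GenTree.Node 3 [:: f; g] =>
      nat_rect _ (eval f 0 (behead v))
        (fun k r => eval g 0 [:: k, r & behead v]) (head 0 v)
  | GenTree.Node 4 [:: f] =>
      xget 0 [set y | eval f 0 (y :: v) = 0 /\
        forall z, z < y -> eval f 0 (z :: v) <> 0]
  | GenTree.Node 5 [:: f; g] => if i is j.+1 then eval g j v else eval f 0 v
  | _ => 0
  end.

Lemma eval_list (ts : seq tree) t0 j v : j < size ts ->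
  eval (foldr (fun t u => GenTree.Node 5 [:: t; u]) t0 ts) j v =
  eval (nth t0 ts j) 0 v.
Proof. by elim: ts j => //= t ts ih [|j] //=; rewrite ltnS => /ih. Qed.

(** The trees form a countable type, so a code for each recursive function bounds their number.
    Default values make [eval] total, hence codes need not be checked for being well formed. *)
Lemma recursive_eval n (f : n.-tuple nat -> nat) : recursive f ->
  exists t, forall v, f v = eval t 0 v.
Proof.
elim => {n f} [n||n i|m n f g h _ [tf Hf] _ IHg hE|
  n f g h _ [tf Hf] _ [tg Hg] h0 hS|n f h _ [tf Hf] h0 hmin].
- by exists (GenTree.Node 0 [::]).
- by exists (GenTree.Node 1 [::]) => v; rewrite /= /thead (tnth_nth 0).
- by exists (GenTree.Leaf (i : nat)) => v; rewrite /= (tnth_nth 0).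
- have [tg tgP] := choice IHg.
  pose d := GenTree.Leaf 0 : tree.
  exists (GenTree.Node 2 [:: GenTree.Leaf m; tf;
    foldr (fun t u => GenTree.Node 5 [:: t; u]) d (map tg (enum 'I_m))]) => v.
  rewrite hE Hf /=; congr eval.
  have szm : size (map tg (enum 'I_m)) = m by rewrite size_map size_enum_ord.
  apply: (@eq_from_nth _ 0).
    by rewrite [LHS](size_tuple [tuple g i v | i < m]) size_map size_iota.
  move=> i; rewrite [X in _ < X](size_tuple [tuple g i v | i < m]) => im.
  rewrite -[LHS](tnth_nth 0 [tuple g i v | i < m] (Ordinal im)) tnth_mktuple.
  rewrite (nth_map 0) ?size_iota // nth_iota // add0n eval_list ?szm // tgP.
  rewrite (nth_map (Ordinal im)) ?size_enum_ord //; congr (eval (tg _) 0 v).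
  by apply/val_inj; rewrite /= nth_enum_ord.
- exists (GenTree.Node 3 [:: tf; tg]) => v.
  case/tupleP: v => k v; rewrite /=; elim: k => [|k ih] /=.
    by rewrite -Hf -h0.
  by rewrite hS Hg /= ih.
- have fE (v : n.-tuple nat) y : f [tuple of y :: v] = eval tf 0 (y :: v).
    by rewrite Hf.
  have ex (v : n.-tuple nat) : exists y, eval tf 0 (y :: v) = 0 /\
      forall z, z < y -> eval tf 0 (z :: v) <> 0.
    by exists (h v); split=> [|z zh]; rewrite -fE; [exact: h0|exact: hmin].
  exists (GenTree.Node 4 [:: tf]) => v.
  have := xgetPex 0 (ex v); rewrite -[xget _ _]/(eval (GenTree.Node 4 [:: tf]) 0 v).
  move: (eval (GenTree.Node 4 _) 0 v) => y [y0 ymin].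
  case: (ltngtP (h v) y) => // lt.
    by have := ymin _ lt; rewrite -fE h0.
  by have := hmin v y lt; rewrite fE y0.
Qed.

Lemma computable_countable : countable [set f | computable f].
Proof.
apply: (@sub_countable _ _ _ (range (fun t x => eval t 0 [:: x]))).
  apply: subset_card_le => f /recursive_eval [t tE]; exists t => //.
  by apply/funext => x; rewrite -(tE [tuple x]).
exact: card_le_trans (card_image_le _ _) (countableP _).
Qed.

End countability.

(** * Words *)

(* A positive number stands for a nonempty word over [nat]: [wcons n w] has first
   letter [n] and rest [w], and [0] is the empty word. In binary, [n] is the
   number of trailing zeros. *)
Definition letter (x : nat) : nat := logn 2 x.
Definition rest (x : nat) : nat := x %/ 2 ^ (letter x).+1.
Definition wcons (n w : nat) : nat := 2 ^ n.+1 * w + 2 ^ n.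

Lemma wcons_gt0 n w : 0 < wcons n w.
Proof. by rewrite addn_gt0 expn_gt0 orbT. Qed.

Lemma ltn_wcons n w : w < wcons n w.
Proof.
rewrite -[X in X < _]muln1 mulnC /wcons -addn1 leq_add ?expn_gt0 //.
by rewrite leq_mul2r expn_gt0 orbT.
Qed.

Lemma ltn_base_letter n : 2 ^ n < 2 ^ n.+1.
Proof. by rewrite ltn_exp2l. Qed.

Lemma wcons_div n w : wcons n w %/ 2 ^ n.+1 = w.
Proof.
by rewrite /wcons mulnC divnMDl ?expn_gt0 // divn_small ?ltn_base_letter ?addn0.
Qed.

Lemma wcons_mod n w : wcons n w %% 2 ^ n.+1 = 2 ^ n.
Proof. by rewrite /wcons mulnC modnMDl modn_small // ltn_base_letter. Qed.

Lemma mod_wcons n x : x %% 2 ^ n.+1 = 2 ^ n -> x = wcons n (x %/ 2 ^ n.+1).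
Proof. by move=> xn; rewrite {1}(divn_eq x (2 ^ n.+1)) xn /wcons mulnC. Qed.

Lemma letter_wcons n w : letter (wcons n w) = n.
Proof.
rewrite /letter /wcons expnSr -mulnA -{2}[2 ^ n]muln1 -mulnDr lognM //; last first.
- by rewrite addn1.
- by rewrite expn_gt0.
rewrite pfactorK // -[RHS]addn0; congr addn.
by rewrite logn_coprime // coprime2n addn1 /= oddM.
Qed.

Lemma rest_wcons n w : rest (wcons n w) = w.
Proof. by rewrite /rest letter_wcons wcons_div. Qed.

Lemma wcons_letter_rest x : 0 < x -> x = wcons (letter x) (rest x).
Proof.
move=> x0; apply: mod_wcons; rewrite /letter.
have [m om xE] := pfactor_coprime (isT : prime 2) x0.
rewrite {1}xE expnS -muln_modl modn2.
by move: om; rewrite coprime2n => ->; rewrite mul1n.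
Qed.

Lemma ltn_rest x : 0 < x -> rest x < x.
Proof. by move=> x0; rewrite {2}(wcons_letter_rest x0) ltn_wcons. Qed.

(** * Words as positions: their action, their columns and the toggling of letters *)

Section positions.
Variables (Y : Type) (theta : nat -> Y -> Y).

(* All letters but the last one act, the first letter first; the last letter
   names the column of the word. *)
Fixpoint act_fuel k x (y : Y) : Y :=
  if k is k'.+1 then
    if rest x == 0 then y else act_fuel k' (rest x) (theta (letter x) y)
  else y.

Definition act x : Y -> Y := act_fuel x x.

Lemma act_fuelE k x y : x <= k -> act_fuel k x y = act x y.
Proof.
rewrite /act; elim/ltn_ind: k x y => -[|k] ih [|x] y //= xk.
case: eqP => // _; have := ltn_rest (ltn0Sn x) => rx.
rewrite ih //; last by rewrite -ltnS (leq_trans rx).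
by rewrite [RHS]ih // -ltnS.
Qed.

Lemma act_wcons0 n y : act (wcons n 0) y = y.
Proof. by rewrite /act; case: (wcons n 0) (rest_wcons n 0) => //= x ->. Qed.

Lemma act_wcons n w y : 0 < w -> act (wcons n w) y = act w (theta n y).
Proof.
move=> w0; rewrite {1}/act.
case E : (wcons n w) (wcons_gt0 n w) => [//|x] _ /=.
rewrite -E rest_wcons letter_wcons; case: eqP w0 => [->//|_ w0].
by rewrite act_fuelE // -ltnS -E ltn_wcons.
Qed.

(** Columns of words are shifted by one, so that column [0] contains only the position [0], the
    empty word, which every toggle fixes. *)
Fixpoint column_fuel k x : nat :=
  if k is k'.+1 then
    if rest x == 0 then (letter x).+1 else column_fuel k' (rest x)
  else 0.

Definition column x : nat := column_fuel x x.

Lemma column_fuelE k x : x <= k -> 0 < x -> column_fuel k x = column x.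
Proof.
rewrite /column; elim/ltn_ind: k x => -[|k] ih [|x] //= xk _.
case: eqP => // r0; have := ltn_rest (ltn0Sn x) => rx.
have r_gt0 : 0 < rest x.+1 by rewrite lt0n; apply/eqP.
rewrite ih //; last by rewrite -ltnS (leq_trans rx).
by rewrite [RHS]ih // -ltnS.
Qed.

Lemma column_wcons0 n : column (wcons n 0) = n.+1.
Proof.
rewrite /column; case E : (wcons n 0) (wcons_gt0 n 0) => [//|x] _ /=.
by rewrite -E rest_wcons letter_wcons.
Qed.

Lemma column_wcons n w : 0 < w -> column (wcons n w) = column w.
Proof.
move=> w0; rewrite {1}/column.
case E : (wcons n w) (wcons_gt0 n w) => [//|x] _ /=.
rewrite -E rest_wcons; case: eqP w0 => [->//|_ w0].
by rewrite column_fuelE // -ltnS -E ltn_wcons.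
Qed.

(* [run n x] counts the leading letters [n] of the word [x], its last letter
   excepted. *)
Definition runs n x := (x %% 2 ^ n.+1 == 2 ^ n) && (2 ^ n.+1 <= x).

Fixpoint run_fuel k n x : nat :=
  if k is k'.+1 then
    if runs n x then (run_fuel k' n (x %/ 2 ^ n.+1)).+1 else 0
  else 0.

Definition run n x := run_fuel x n x.

Lemma runs_wcons n w : runs n (wcons n w) = (0 < w).
Proof.
rewrite /runs wcons_mod eqxx /= -{1}[2 ^ n.+1]mul1n -leq_divRL ?expn_gt0 //.
by rewrite wcons_div.
Qed.

Lemma run_fuelE k n x : x <= k -> run_fuel k n x = run n x.
Proof.
rewrite /run; elim/ltn_ind: k x => -[|k] ih [|x] //= xk.
  by rewrite /runs mod0n eq_sym expn_eq0.
case: ifP => // /andP[_ Mx]; congr _.+1.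
have lt : x.+1 %/ 2 ^ n.+1 < x.+1 by rewrite ltn_Pdiv // -{1}[1]/(2 ^ 0) ltn_exp2l.
rewrite ih //; last by rewrite -ltnS (leq_trans lt).
by rewrite [RHS]ih // -ltnS.
Qed.

Lemma runE n x : run n x = if runs n x then (run n (x %/ 2 ^ n.+1)).+1 else 0.
Proof.
case: x => [|x]; first by rewrite /runs mod0n eq_sym expn_eq0.
rewrite {1}/run /=; case: ifP => // _; rewrite run_fuelE // -ltnS.
by rewrite ltn_Pdiv // -{1}[1]/(2 ^ 0) ltn_exp2l.
Qed.

(** Words are not reduced, so prepending [n] alone is not an involution. The parity of the leading
    run of [n] decides: an even run is lengthened and an odd run shortened by one, which reverses
    the parity. *)
Definition toggle n x :=
  if x == 0 then 0 else if odd (run n x) then x %/ 2 ^ n.+1 else wcons n x.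

Lemma toggleK n : involutive (toggle n).
Proof.
move=> x; rewrite {2}/toggle; case: (posnP x) => [->//|x0].
case: ifP => ox; last first.
  rewrite /toggle; case: posnP (wcons_gt0 n x) => // _ _.
  by rewrite runE runs_wcons x0 wcons_div /= ox.
move: ox; rewrite runE; case: ifP => // xr /=.
have /andP[/eqP/mod_wcons xE _] := xr.
rewrite xE runs_wcons in xr; rewrite /toggle => /negbTE ->.
by case: posnP xr => // _; rewrite -xE.
Qed.

(** Removing a leading [n] has the same effect as prepending one, because [theta n] is its own
    inverse. *)
Lemma act_toggle n x y : 0 < x -> involutive (theta n) ->
  act (toggle n x) y = act x (theta n y).
Proof.
move=> x0 tK; rewrite /toggle; case: posnP x0 => // x0 _.
case: ifP => [|_]; last exact: act_wcons.
rewrite runE; case: ifP => // xr _.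
have /andP[/eqP/mod_wcons xE _] := xr.
by rewrite {2}xE act_wcons ?tK //; rewrite xE runs_wcons in xr.
Qed.

Lemma column_toggle n x : column (toggle n x) = column x.
Proof.
rewrite /toggle; case: posnP => [->//|x0].
case: ifP => [|_]; last exact: column_wcons.
rewrite runE; case: ifP => // xr _.
have /andP[/eqP/mod_wcons xE _] := xr.
by rewrite {2}xE column_wcons //; rewrite xE runs_wcons in xr.
Qed.

End positions.

Lemma computable_toggle n : computable (toggle n).
Proof.
set M := 2 ^ n.+1; set c := 2 ^ n.
have M0 : 0 < M by rewrite expn_gt0.
pose q k x := iter k (divn^~ M) x.
have rq : recursive2 q.
  apply: (@recursive2_prec id (fun r _ => r %/ M)) => //.
    exact: computable_id.
  exact: (recursive_comp1 (computable_divn M0) recursive_fst).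
pose t x := (x %% M - c) + (c - x %% M) + (M - x).
have t0 x : (t x == 0) = runs n x.
  by rewrite /t !addn_eq0 !subn_eq0 -eqn_leq.
have rt : computable t.
  apply: (recursive_comp2 recursive_add); last first.
    apply: (recursive_comp2 recursive_sub); first exact: recursive_cst.
    exact: computable_id.
  by apply: (recursive_comp2 recursive_add);
    apply: (recursive_comp2 recursive_sub); do ?exact: recursive_cst;
    exact: (computable_modn M0).
have r_run : computable (run n).
  (* The run is the least number of divisions after which the test [runs n] fails; [1 - t] turns
     this failure into a zero. *)
  apply: (@recursive2_mu (fun k x => 1 - t (q k x))).
  - apply: (recursive_comp2 recursive_sub); first exact: recursive_cst.
    exact: (recursive_comp1 rt rq).
  - move=> x; apply/eqP; rewrite subn_eq0 lt0n t0.
    elim/ltn_ind: x => x ih; rewrite runE; case: ifP => [xr|/= ->//].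
    rewrite /q iterSr; apply: ih; apply: ltn_Pdiv.
      by rewrite -{1}[1]/(2 ^ 0) ltn_exp2l.
    by have /andP[_] := xr; apply: leq_trans.
  - move=> x k kx /eqP; rewrite subn_eq0 lt0n t0; apply/negP/negPn.
    elim: k x kx => [|k ih] x; first by rewrite runE /=; case: ifP.
    by rewrite runE; case: ifP => // _; rewrite ltnS /q iterSr => /ih.
(* [s] is the sign function: it makes the formula below vanish at [0], where [wcons n 0] does
   not. *)
pose s x := 1 - (1 - x).
have rs : computable s.
  apply: (recursive_comp2 recursive_sub); first exact: recursive_cst.
  apply: (recursive_comp2 recursive_sub); first exact: recursive_cst.
  exact: computable_id.
pose p x := run n x %% 2.
have rp : computable p := computable_comp (computable_modn (isT : 0 < 2)) r_run.
suff : computable (fun x => (1 - p x) * (M * x + c * s x) + p x * (x %/ M)).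
  move=> /eq_recursive; apply => v; rewrite /toggle /p modn2.
  case: posnP => [->|x0]; first by rewrite !muln0 div0n muln0.
  case: odd; rewrite ?mul0n ?mul1n // addn0 /wcons.
  by rewrite /s; case: (thead v) x0 => // k _; rewrite muln1.
apply: (recursive_comp2 recursive_add).
  apply: (recursive_comp2 recursive_mul).
    by apply: (recursive_comp2 recursive_sub); first exact: recursive_cst.
  apply: (recursive_comp2 recursive_add).
    apply: (recursive_comp2 recursive_mul); first exact: recursive_cst.
    exact: computable_id.
  by apply: (recursive_comp2 recursive_mul); first exact: recursive_cst.
apply: (recursive_comp2 recursive_mul) => //.
exact: (computable_divn M0).
Qed.

(** * Colourings *)

Section discrete_measurable.
Context d (T : measurableType d).

(* Measurability of a map into a countable set, without any structure on the
   codomain. *)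
Definition dmeasurable (A : Type) (f : T -> A) : Prop :=
  forall a, measurable (f @^-1` [set a]).

Lemma dmeasurable_preimage (A : countType) (f : T -> A) (S : set A) :
  dmeasurable f -> measurable (f @^-1` S).
Proof.
move=> mf; have -> : f @^-1` S = \bigcup_(a in S) (f @^-1` [set a]).
  by apply/seteqP; split => [x Sfx|x [a Sa /= ->//]]; exists (f x).
rewrite bigcup_mkcond; apply: countable_bigcupT_measurable => [|a].
  exact: countableP.
by case: ifP => _; [exact: mf|exact: measurable0].
Qed.

Lemma dmeasurable_comp (A : countType) (B : Type) (f : T -> A) (g : A -> B) :
  dmeasurable f -> dmeasurable (g \o f).
Proof.
by move=> mf b; rewrite comp_preimage; exact: dmeasurable_preimage.
Qed.

Lemma dmeasurable_pair (A B : Type) (f : T -> A) (g : T -> B) :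
  dmeasurable f -> dmeasurable g -> dmeasurable (fun t => (f t, g t)).
Proof.
move=> mf mg [a b].
have -> : (fun t => (f t, g t)) @^-1` [set (a, b)] =
    f @^-1` [set a] `&` g @^-1` [set b].
  by apply/seteqP; split => t /= [-> ->].
exact: measurableI.
Qed.

Lemma dmeasurable2 (A B : countType) (C : Type) (f : T -> A) (g : T -> B)
    (h : A -> B -> C) :
  dmeasurable f -> dmeasurable g -> dmeasurable (fun t => h (f t) (g t)).
Proof.
move=> mf mg.
exact: (dmeasurable_comp (fun p => h p.1 p.2) (dmeasurable_pair mf mg)).
Qed.

Lemma dmeasurable3 (A B C : countType) (D : Type) (f : T -> A) (g : T -> B)
    (k : T -> C) (h : A -> B -> C -> D) :
  dmeasurable f -> dmeasurable g -> dmeasurable k ->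
  dmeasurable (fun t => h (f t) (g t) (k t)).
Proof.
move=> mf mg mk.
exact: (dmeasurable2 (fun p => h p.1 p.2) (dmeasurable_pair mf mg)).
Qed.

Lemma dmeasurable_cst (A : Type) (a : A) : dmeasurable (fun _ : T => a).
Proof.
move=> b; have [->|ab] := pselect (a = b).
  by rewrite (_ : _ @^-1` _ = setT) //; apply/seteqP; split.
by rewrite (_ : _ @^-1` _ = set0) //; apply/seteqP; split.
Qed.

Lemma dmeasurable_bool (p : T -> bool) :
  measurable [set t | p t] -> dmeasurable p.
Proof.
move=> mp [].
  by rewrite (_ : _ @^-1` _ = [set t | p t]) //; apply/seteqP; split.
rewrite (_ : _ @^-1` _ = ~` [set t | p t]); first exact: measurableC.
by apply/seteqP; split => t /=; [move=> ->|move/negP/negbTE].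
Qed.

Lemma dmeasurable_exists (p : nat -> T -> bool) :
  (forall n, dmeasurable (p n)) -> dmeasurable (fun t => `[< exists n, p n t >]).
Proof.
move=> mp; apply: dmeasurable_bool.
rewrite (_ : [set t | _] = \bigcup_n (p n @^-1` [set true])).
  by apply: bigcupT_measurable => n; exact: mp.
apply/seteqP; split => t /=; first by move/asboolP => [n pn]; exists n.
by case=> n _ /= pn; apply/asboolP; exists n.
Qed.

End discrete_measurable.

Lemma dmeasurable_precomp d d' (T : measurableType d) (U : measurableType d')
    (A : Type) (a : T -> U) (f : U -> A) :
  measurable_fun setT a -> dmeasurable f -> dmeasurable (f \o a).
Proof.
move=> ma mf b; rewrite comp_preimage -[X in measurable X]setTI.
exact: ma.
Qed.

(* [0] if no number satisfies [p]. *)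
Definition least (p : nat -> bool) : nat :=
  if pselect (exists n, p n) is left e then ex_minn e else 0.

Lemma leastP (p : nat -> bool) n : p n ->
  p (least p) /\ forall m, m < least p -> ~~ p m.
Proof.
move=> pn; rewrite /least; case: pselect => [e|[]]; last by exists n.
case: ex_minnP => k pk kmin; split => // m mk; apply/negP => /kmin.
by rewrite leqNgt mk.
Qed.

Lemma least_unique (p : nat -> bool) n : p n ->
  (forall m, m < n -> ~~ p m) -> least p = n.
Proof.
move=> pn nmin; have [pl lmin] := leastP pn; case: (ltngtP (least p) n) => //.
  by move/nmin; rewrite pl.
by move/lmin; rewrite pn.
Qed.

Lemma dmeasurable_least d (T : measurableType d) (p : nat -> T -> bool) :
  (forall n, dmeasurable (p n)) -> dmeasurable (fun t => least (p ^~ t)).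
Proof.
move=> mp k.
have mall n : dmeasurable (fun t => [forall m : 'I_n, ~~ p m t]).
  elim: n => [|n ih].
    rewrite (_ : (fun _ => _) = fun=> true); first exact: dmeasurable_cst.
    by apply/funext => t; apply/forallP => -[].
  have := dmeasurable2 (fun a b => a && ~~ b) ih (mp n).
  congr dmeasurable; apply/funext => t; apply/andP/forallP.
    move=> [/forallP a b] m; have := ltn_ord m; rewrite ltnS leq_eqVlt.
    by move=> /orP[/eqP ->//|mn]; exact: (a (Ordinal mn)).
  move=> a; split; last exact: (a ord_max).
  by apply/forallP => m; exact: (a (widen_ord (leqnSn n) m)).
(* The value is [k] either because [k] is the first number satisfying [p], or because [k] is the
   default [0] and no number does. *)
have := dmeasurable3 (fun a b c => a && b || (k == 0) && ~~ c)
  (mp k) (mall k) (dmeasurable_exists mp).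
move=> /(_ true); congr measurable; apply/seteqP; split => t /=.
  case/orP.
    move=> /andP[pk /forallP a]; apply: least_unique => // m mk.
    exact: (a (Ordinal mk)).
  move=> /andP[/eqP -> /asboolPn no]; rewrite /least; case: pselect => //.
case: (pselect (exists n, p n t)) => [[n pn] <-|no].
  have [-> lmin] := @leastP (p ^~ t) n pn.
  apply/orP; left => /=; apply/forallP => m.
  exact: lmin.
rewrite {1}/least; case: pselect => // _ <-.
by apply/orP; right; rewrite eqxx; apply/asboolPn.
Qed.

(** * Borel 3-colourings with twisted constraints *)

Section coloring.
Context d (Y : measurableType d).
Variable sep : nat -> Y -> bool.
Hypothesis sep_meas : forall i, dmeasurable (sep i).
Hypothesis sepP : forall x y, x <> y -> exists i, sep i x && ~~ sep i y.

Lemma dmeasurable_neq (h : Y -> Y) : measurable_fun setT h ->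
  dmeasurable (fun y => `[< h y <> y >]).
Proof.
move=> mh; have := dmeasurable_exists (fun i =>
  dmeasurable2 (fun a b => a && ~~ b) (dmeasurable_precomp mh (sep_meas i))
    (sep_meas i)).
congr dmeasurable; apply/funext => y; apply/asbool_equiv_eq; split.
  by move=> [i /andP[/= a b]] hy; rewrite hy in a; rewrite a in b.
exact: sepP.
Qed.

Section twisted_coloring.
Variables (h h' : nat -> Y -> Y) (s : nat -> Y -> 'I_3).
Hypothesis hK : forall n, cancel (h n) (h' n).
Hypothesis h_meas : forall n, measurable_fun setT (h n).
Hypothesis h'_meas : forall n, measurable_fun setT (h' n).
Hypothesis s_meas : forall n, dmeasurable (s n).

(** A point moved by some map gets one edge, to [T y]. Points are ordered lexicographically by the
    index of the first moving map and by the first separating set that contains [y] but not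
    [T y]. *)
Let moves n y := `[< h n y <> y >].
Let r y := least (moves ^~ y).
Let T y := h (r y) y.
Let idx y := least (fun i => sep i y && ~~ sep i (T y)).
Let lt_rank (a b : nat * nat) := (a.1 < b.1) || (a.1 == b.1) && (a.2 < b.2).
Let rank y := (r y, idx y).

Let lt_rank_ind (P : nat * nat -> Prop) :
  (forall a, (forall b, lt_rank b a -> P b) -> P a) -> forall a, P a.
Proof.
move=> H [m n]; elim/ltn_ind: m n => m ihm; elim/ltn_ind => n ihn.
apply: H => -[m' n'] /orP[|/andP[/eqP /= ->]]; last exact: ihn.
by move=> /ihm; exact.
Qed.

Let lt_rank_wf : well_founded (fun x y : Y => lt_rank (rank x) (rank y)).
Proof.
move=> y; have [a] : exists a, a = rank y by exists (rank y).
elim/lt_rank_ind: a y => a ih y aE; constructor => x; rewrite -aE => xa.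
exact: (ih _ xa).
Qed.

Let avoid (a b : option 'I_3) : 'I_3 :=
  odflt ord0 [pick c | (Some c != a) && (Some c != b)].

Let avoidP a b : Some (avoid a b) != a /\ Some (avoid a b) != b.
Proof.
rewrite /avoid; case: pickP => [c /andP[]//|no]; exfalso.
move: (no ord0) (no (@Ordinal 3 1 isT)) (no (@Ordinal 3 2 isT)) => {no}.
case: a b => [[[|[|[|//]]] ?]|] [[[|[|[|//]]] ?]|];
  by vm_compute.
Qed.

Let constraint n y (e e' : option 'I_3) : option 'I_3 * option 'I_3 :=
  (omap (fun c => (c - s n y)%R) e, if r (h' n y) == n then
     omap (fun c => (c + s n (h' n y))%R) e' else None).

(* Greedy colouring in the order of [rank]: the image and the preimage of [y]
   under [T], if they come before [y], each forbid at most one colour.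
   Preimages [x] with [r y < r x] come after [y]. *)
Let color_body y (rec : forall x, lt_rank (rank x) (rank y) -> 'I_3) : 'I_3 :=
  let look x := if pselect (lt_rank (rank x) (rank y)) is left p
    then Some (rec x p) else None in
  let c := constraint (r y) y (look (h (r y) y)) (look (h' (r y) y)) in
  avoid c.1 c.2.

Let color : Y -> 'I_3 := Fix lt_rank_wf (fun=> 'I_3) color_body.

Let before a x := if lt_rank (rank x) a then Some (color x) else None.

Let colorE y : color y =
  let e := before (rank y) (h (r y) y) in
  let e' := before (rank y) (h' (r y) y) in
  avoid (constraint (r y) y e e').1 (constraint (r y) y e e').2.
Proof.
rewrite /color Fix_eq; last first.
  move=> x f g fg; congr color_body.
  by apply/functional_extensionality_dep => z; apply/funext => p.
have lookE x : before (rank y) x =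
    if pselect (lt_rank (rank x) (rank y)) is left _ then Some (color x)
    else None.
  by rewrite /before; case: pselect => [->|/negP/negbTE ->].
by rewrite !lookE.
Qed.

Let rP n y : moves n y -> moves (r y) y /\ forall m, m < r y -> ~~ moves m y.
Proof. exact: leastP. Qed.

Let r_T n y : moves n y -> moves (r y) (T y).
Proof.
move=> /rP[/asboolP my _]; apply/asboolP => /(congr1 (h' (r y))).
by rewrite /T !hK.
Qed.

Let leq_r_T n y : moves n y -> r (T y) <= r y.
Proof.
move=> my; have mT := r_T my; have [_ /(_ (r y))] := rP mT.
by case: (leqP (r (T y)) (r y)) => // _ /(_ isT); rewrite mT.
Qed.

(** The separating set numbered [idx y] excludes [T y], whereas the one numbered [idx (T y)]
    contains it. *)
Let idx_neq n y : moves n y -> idx y <> idx (T y).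
Proof.
move=> my; have mT := r_T my.
have sepT z k : moves k z -> sep (idx z) z && ~~ sep (idx z) (T z).
  move=> /rP[/asboolP mz _].
  have [i] := sepP (not_eq_sym mz).
  by move=> /(@leastP (fun i => sep i z && ~~ sep i (T z)))[].
by move=> E; have := sepT _ _ my; have := sepT _ _ mT; rewrite -E;
  move=> /andP[-> _] /andP[].
Qed.

Let color_proper n y : moves n y -> color (T y) <> (color y + s (r y) y)%R.
Proof.
move=> my; have := leq_r_T my; have := idx_neq my => iN rT.
(* The end of the edge that comes later was coloured subject to the constraint from the other
   end. *)
have [lt|ge] := boolP (lt_rank (rank (T y)) (rank y)).
  rewrite [color y]colorE; cbv zeta; set c := constraint _ _ _ _.
  have [+ _] := avoidP c.1 c.2; set a := avoid _ _.
  rewrite /c /constraint /= /before -/(T y) lt /= => + E.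
  by rewrite E addrK eqxx.
(* As [T y] does not precede [y], the values of [r] agree and the distinct values of [idx] place [y]
   first; [y] is then the preimage examined when [T y] is coloured. *)
have rE : r (T y) = r y.
  apply/eqP; rewrite eqn_leq rT leqNgt; apply: contra ge => lt.
  by rewrite /lt_rank lt.
have lt : lt_rank (rank y) (rank (T y)).
  rewrite /lt_rank /= rE eqxx ltnn /=; rewrite /lt_rank /= rE eqxx ltnn /= in ge.
  by rewrite ltn_neqAle leqNgt ge andbT; apply/eqP.
rewrite [color (T y)]colorE; cbv zeta; set c := constraint _ _ _ _.
have [_] := avoidP c.1 c.2; set a := avoid _ _.
rewrite /c /constraint /= rE /T hK eqxx /before -/(T y) lt /= => + E.
by rewrite -E eqxx.
Qed.

Let r_meas : dmeasurable r.
Proof. by apply: dmeasurable_least => n; exact: dmeasurable_neq. Qed.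

Let idx_meas : dmeasurable idx.
Proof.
apply: dmeasurable_least => i.
apply: (dmeasurable2 (fun a b => a && ~~ b)) => // a.
rewrite (_ : _ @^-1` _ =
    \bigcup_n (r @^-1` [set n] `&` (sep i \o h n) @^-1` [set a])).
  apply: bigcupT_measurable => n; apply: measurableI; first exact: r_meas.
  exact: dmeasurable_precomp.
apply/seteqP; split => y /=; first by move=> E; exists (r y).
by case=> n _ [/= rn <-]; rewrite /T rn.
Qed.

Let rank_meas : dmeasurable rank.
Proof. exact: dmeasurable_pair. Qed.

(** There are countably many ranks, and the colour at rank [a] depends only on colours of smaller
    rank. On points of rank [a] the map [h (r y)] is the single map [h a.1], so induction on the
    rank applies. *)
Let color_meas : dmeasurable color.
Proof.
pose at_ a y := if rank y == a then Some (color y) else None.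
suff at_meas a : dmeasurable (at_ a).
  move=> c; rewrite (_ : _ @^-1` _ = \bigcup_a (at_ a @^-1` [set Some c])).
    apply: countable_bigcupT_measurable => [|a]; first exact: countableP.
    exact: at_meas.
  apply/seteqP; split => y /=; first move=> <-.
    by exists (rank y); rewrite /at_ //= eqxx.
  by case=> a _; rewrite /at_ /=; case: ifP => // _ [].
elim/lt_rank_ind: a => a ih.
have before_meas : dmeasurable (before a).
  have some c : measurable (before a @^-1` [set Some c]).
    rewrite (_ : _ @^-1` _ = \bigcup_b
        (if lt_rank b a then at_ b @^-1` [set Some c] else set0)).
      apply: countable_bigcupT_measurable => [|b]; first exact: countableP.
      by case: ifP => [/ih|_]; [exact|exact: measurable0].
    apply/seteqP; split => y /=.
      rewrite /before; case: ifP => // lt [<-]; exists (rank y) => //.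
      by rewrite lt /at_ /= eqxx.
    case=> b _; case: ifP => // lt; rewrite /at_ /=; case: eqP => // E [<-].
    by rewrite /before E lt.
  case=> [c|]; first exact: some.
  rewrite (_ : _ @^-1` _ = ~` \bigcup_c (before a @^-1` [set Some c])).
    apply: measurableC; apply: countable_bigcupT_measurable => [|c].
      exact: countableP.
    exact: some.
  apply/seteqP; split => y /=; first by move=> E [c _ /=]; rewrite E.
  by case E : (before a y) => [c|//] []; exists c.
rewrite (_ : at_ a = fun y => if rank y == a then
    Some (let c := constraint a.1 y (before a (h a.1 y)) (before a (h' a.1 y)) in
      avoid c.1 c.2) else None); last first.
  by apply/funext => y; rewrite /at_; case: eqP => // <-; rewrite [in LHS]colorE.
apply: (dmeasurable2 (fun b c => if b == a then Some c else None)) => //.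
apply: (dmeasurable2 avoid) => /=.
  apply: (dmeasurable2 (fun x y => omap (fun c => (c - y)%R) x)) => //.
  exact: (dmeasurable_precomp (h_meas a.1)).
apply: (dmeasurable3 (fun x y z =>
  if x == a.1 then omap (fun c => (c + y)%R) z else None)).
- exact: (dmeasurable_precomp (h'_meas a.1)).
- exact: (dmeasurable_precomp (h'_meas a.1)).
- exact: (dmeasurable_precomp (h'_meas a.1)).
Qed.

(* Although infinitely many edges may end at a point, three colours suffice:
   if [h n] is the first map moving [y], it also moves [h n y], so that the
   index of the first moving map does not increase along edges, and among points
   of the same index the edges form a graph of degree at most two. *)
Lemma twisted_coloring : exists2 c : Y -> 'I_3, dmeasurable c &
  forall n y, h n y <> y -> (forall m, m < n -> h m y = y) ->
    c (h n y) <> (c y + s n y)%R.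
Proof.
exists color => // n y hy hm.
have my : moves n y by apply/asboolP.
suff -> : n = r y by exact: color_proper my.
apply/esym/least_unique => // m mn; apply/asboolPn; rewrite hm //; exact.
Qed.

End twisted_coloring.
End coloring.

(** * Diagonalization against permutations *)

Lemma infinite_enum (S : set nat) : infinite_set S ->
  exists2 s : nat -> nat, injective s & forall n, S (s n).
Proof.
move=> /infiniteP/pcard_leP[s]; exists s => [m n|n].
  by apply: 'inj_s; rewrite inE.
exact: 'funS_s.
Qed.

Section diagonalization.
Context d (Y : measurableType d).
Variable sep : nat -> Y -> bool.
Hypothesis sep_meas : forall i, dmeasurable (sep i).
Hypothesis sepP : forall x y, x <> y -> exists i, sep i x && ~~ sep i y.
Variables (A A' : nat -> Y -> Y) (col e : nat -> nat).
Hypothesis AK : forall x, cancel (A x) (A' x).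
Hypothesis A'K : forall x, cancel (A' x) (A x).
Hypothesis A_meas : forall x, measurable_fun setT (A x).
Hypothesis A'_meas : forall x, measurable_fun setT (A' x).
Hypothesis Ae : forall j y, A (e j) y = y.
Hypothesis col_e : forall j, col (e j) = j.

Implicit Types (c : nat -> Y -> 'I_3) (D : set nat) (g : nat -> nat).

Definition coded c (y : Y) (x : nat) : 'I_3 := c (col x) (A x y).

(* The columns in [D] already prevent [g] from identifying codes of unrelated
   points, however the other columns are chosen. *)
Definition settled D c g : Prop :=
  forall c', (forall j, D j -> c' j = c j) ->
  forall y y', (forall x, coded c' y' x = coded c' y (g x)) ->
  exists x, y' = A x y \/ y = A x y'.

Definition settleable D c g : Prop :=
  exists D' c', [/\ D `<=` D', infinite_set (~` D'),
    forall j, D j -> c' j = c j,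
    forall j, dmeasurable (c' j) & settled D' c' g].

Lemma coded_e c y j : coded c y (e j) = c j y.
Proof. by rewrite /coded col_e Ae. Qed.

(** The conclusion of [settled] is symmetric in the two points, and exchanging them turns [g] into
    its inverse. *)
Lemma settled_inv D c g g' : cancel g' g -> settled D c g' -> settled D c g.
Proof.
move=> gK S c' cc' y y' yy'.
have [x|x []] := S _ cc' y' y; last 2 first.
- by exists x; right.
- by exists x; left.
by rewrite yy' gK.
Qed.

Definition bit i y : 'I_3 := if sep i y then (@Ordinal 3 1 isT) else ord0.

Lemma bit_inj y y' : (forall i, bit i y = bit i y') -> y = y'.
Proof.
move=> E; apply: contrapT => /sepP[i]; have := E i; rewrite /bit.
by case: (sep i y) => //; case: (sep i y').
Qed.

Lemma bit_meas i : dmeasurable (bit i).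
Proof.
exact: (dmeasurable_comp
  (fun b : bool => if b then (@Ordinal 3 1 isT) else ord0) (sep_meas i)).
Qed.

(* Infinitely many free columns [j] are fixed by [g]: for them the hypothesis on
   the codes reads [c' j y' = c' j (v j)], with [v j] in the orbit of [y]. One of
   them receives a colouring [dd], the others the functions [bit m] and
   [dd + bit m]. The identity [dd y' + bit m y' = (dd + bit m) y'] is a checksum:
   by the choice of [dd] it fails unless the points [v j] used in the last family
   all agree with the point [v] used by [dd], whence [bit m y' = bit m v]. *)
Lemma settle_fixed D c g : (forall j, dmeasurable (c j)) ->
  infinite_set [set j | ~ D j /\ col (g (e j)) = j] ->
  settleable D c g.
Proof.
move=> mc /infinite_enum [s s_inj sS].
(* Only the terms of [s] with odd index are filled; those with even index stay free for later
   stages. *)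
pose s1 t := s t.*2.+1.
have s1_inj : injective s1.
  by move=> m n /s_inj [] E; have := congr1 half E; rewrite !doubleK.
pose pt j := A (g (e j)).
pose b0 := s1 0; pose be m := s1 m.*2.+1; pose si m := s1 m.*2.+2.
(* Since [pt b0] is invertible, what the other columns see is a function of [v = pt b0 y]: column
   [si m] sees [h m v]. If the codes match, the twist [s_ m v] is [bit m y' - bit m (h m v)]. *)
pose h m v := pt (si m) (A' (g (e b0)) v).
pose h' m v := pt b0 (A' (g (e (si m))) v).
pose s_ m v := (bit m (pt (be m) (A' (g (e b0)) v)) - bit m (h m v))%R.
have [dd dd_meas ddP] : exists2 dd : Y -> 'I_3, dmeasurable dd &
  forall n y, h n y <> y -> (forall m, m < n -> h m y = y) ->
    dd (h n y) <> (dd y + s_ n y)%R.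
  apply: (@twisted_coloring _ _ _ sep_meas sepP h h') => n.
  - by move=> v; rewrite /h' /h /pt AK A'K.
  - exact: (measurableT_comp (A_meas _) (A'_meas _)).
  - exact: (measurableT_comp (A_meas _) (A'_meas _)).
  - apply: (dmeasurable2 (fun a b => a - b)%R).
      apply: (dmeasurable_precomp _ (bit_meas n)).
      exact: (measurableT_comp (A_meas _) (A'_meas _)).
    apply: (dmeasurable_precomp _ (bit_meas n)).
    exact: (measurableT_comp (A_meas _) (A'_meas _)).
pose role t : Y -> 'I_3 := if t is t'.+1 then
  if odd t then bit t'./2 else fun y => (dd y + bit t'./2 y)%R else dd.
pose c' j := if pselect (exists t, s1 t == j) is left ex
  then role (ex_minn ex) else c j.
have c's1 t : c' (s1 t) = role t.
  rewrite /c'; case: pselect => [ex|[]]; last by exists t.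
  by case: ex_minnP => n /eqP/s1_inj ->.
exists (D `|` range s1), c'; split.
- by move=> j; left.
- suff : infinite_set (range (fun n => s n.*2)).
    apply: sub_infinite_set => _ [n _ <-] [|[m _]]; first by have [] := sS n.*2.
    by move=> /s_inj E; have := congr1 odd E; rewrite /= !odd_double.
  suff sI : {in setT &, injective (fun n => s n.*2)}.
    by apply/infiniteP; rewrite (card_le_eqr (inj_card_eq sI)) card_lexx.
  by move=> m n _ _ E; have := congr1 half (s_inj _ _ E); rewrite !doubleK.
- move=> j Dj; rewrite /c'; case: pselect => // ex; exfalso.
  have [t /eqP jE] := ex.
  by have [] := sS t.*2.+1; rewrite -/(s1 t) jE.
- move=> j; rewrite /c'; case: pselect => [ex|_]; last exact: mc.
  case: (ex_minn ex) => [//|t]; rewrite /role; case: ifP => _.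
    exact: bit_meas.
  by apply: (dmeasurable2 (fun a b => a + b)%R) => //; exact: bit_meas.
move=> cc ccE y y' yy'.
have eq_at t : role t y' = role t (pt (s1 t) y).
  have := yy' (e (s1 t)); rewrite coded_e /coded; have [_ ->] := sS t.*2.+1.
  by rewrite ccE ?c's1 //; right; exists t.
set v := pt b0 y; have yv : A' (g (e b0)) v = y by rewrite /v /pt AK.
have d0 : dd y' = dd v := eq_at 0.
have eq_be m : bit m y' = bit m (pt (be m) y).
  by have := eq_at m.*2.+1; rewrite /role /= odd_double doubleK.
have eq_si m : (dd y' + bit m y' = dd (h m v) + bit m (h m v))%R.
  have := eq_at m.*2.+2; rewrite /role /= odd_double /= uphalf_double.
  by rewrite /h yv.
have hv m : h m v = v.
  (* If [h m] were the first map to move [v], the checksum would give [dd (h m v) = dd v + s_ m v],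
     which [dd] excludes. *)
  elim/ltn_ind: m => m ih; apply: contrapT => mv.
  apply: (ddP m v mv ih); rewrite /s_ yv -eq_be -d0.
  by rewrite addrA eq_si addrK.
exists (g (e b0)); left; apply: bit_inj => m.
by have := eq_si m; rewrite hv d0 => /addrI.
Qed.

(** Column [j] becomes constantly [0], and [g] leads from [e j] into column [k], constantly [1]. No
    two codes match at [e j], so [settled] holds vacuously. *)
Lemma settle_moved D c g j : (forall j, dmeasurable (c j)) ->
  infinite_set (~` D) -> ~ D j -> ~ D (col (g (e j))) -> col (g (e j)) <> j ->
  settleable D c g.
Proof.
move=> mc Dinf Dj; set k := col _ => Dk kj.
pose c' i := if i == j then cst ord0 else
  if i == k then cst (@Ordinal 3 1 isT) else c i.
exists (D `|` [set j; k]), c'; split.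
- by move=> i; left.
- by rewrite setCU -setDE; apply: infinite_setD => //; exact: finite_set2.
- move=> i Di; rewrite /c'.
  by do 2!(case: eqP => [iE|_]; first by rewrite iE in Di).
- by move=> i; rewrite /c'; do 2!(case: eqP => _; first exact: dmeasurable_cst).
move=> cc ccE y y' /(_ (e j)); rewrite coded_e /coded -/k.
rewrite !ccE; [|by right; right|by right; left].
by rewrite /c' eqxx; case: (k =P j) => // _; rewrite eqxx.
Qed.

(* Both [g (e j)] and [g' (e k)] lie in settled columns, hence the codes of [y]
   and [y'] determine each other in the columns [j] and [k]. *)
Lemma settle_out D c g g' j k : (forall j, dmeasurable (c j)) ->
  infinite_set (~` D) -> cancel g' g -> j <> k -> ~ D j -> ~ D k ->
  D (col (g (e j))) -> D (col (g' (e k))) ->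
  settleable D c g.
Proof.
move=> mc Dinf gK jk Dj Dk Dgj Dgk.
(* With [a] the code of [y] at [g (e j)], position [e j] forces the code of [y'] at [g' (e k)] to be
   [a], and position [g' (e k)] forces it to be [a + 1]. *)
pose c' i := if i == j then coded c ^~ (g' (e k)) else
  if i == k then fun y => (coded c y (g (e j)) + 1)%R else c i.
have mcoded x : dmeasurable (coded c ^~ x).
  by apply: (dmeasurable_precomp (A_meas x)).
have c'D i : D i -> c' i = c i.
  by move=> Di; rewrite /c'; do 2!(case: eqP => [iE|_]; first by rewrite iE in Di).
exists (D `|` [set j; k]), c'; split => //.
- by rewrite setCU -setDE; apply: infinite_setD => //; exact: finite_set2.
- move=> i; rewrite /c'; case: eqP => // _; case: eqP => // _.
  exact: (dmeasurable_comp (fun a => a + 1)%R (mcoded _)).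
move=> cc ccE y y' yy'; exfalso.
have ccD i : D i -> cc i = c i by move=> Di; rewrite ccE ?c'D //; left.
have eqj : coded c y' (g' (e k)) = coded c y (g (e j)).
  have := yy' (e j); rewrite coded_e ccE; last by right; left.
  by rewrite /c' eqxx /coded => ->; rewrite ccD.
have eqk : coded c y' (g' (e k)) = (coded c y (g (e j)) + 1)%R.
  have := yy' (g' (e k)); rewrite gK coded_e ccE; last by right; right.
  rewrite /c'; case: (k =P j) => [kj|_]; first by case: jk.
  by rewrite eqxx => <-; rewrite /coded ccD.
by move: eqk; rewrite eqj -[LHS]addr0 => /addrI.
Qed.

Lemma settle D c g g' : (forall j, dmeasurable (c j)) ->
  infinite_set (~` D) -> cancel g g' -> cancel g' g ->
  settleable D c g.
Proof.
move=> mc Dinf gg' g'g.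
have sym : settleable D c g' -> settleable D c g.
  move=> [D' [c' [H1 H2 H3 H4 H5]]]; exists D', c'; split => //.
  exact: settled_inv H5.
have [|fin] := pselect (infinite_set [set j | ~ D j /\ col (g (e j)) = j]).
  exact: settle_fixed.
have [|fin'] := pselect (infinite_set [set j | ~ D j /\ col (g' (e j)) = j]).
  by move=> H; apply: sym; exact: settle_fixed.
have [[j [Dj Dk kj]]|no] := pselect (exists j,
    [/\ ~ D j, ~ D (col (g (e j))) & col (g (e j)) <> j]).
  exact: (settle_moved mc Dinf Dj Dk kj).
have [[j [Dj Dk kj]]|no'] := pselect (exists j,
    [/\ ~ D j, ~ D (col (g' (e j))) & col (g' (e j)) <> j]).
  by apply: sym; exact: (settle_moved mc Dinf Dj Dk kj).
(* If only finitely many free columns are fixed and none goes to another free column, all but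
   finitely many go to settled ones. *)
have out f (nof : ~ exists j, [/\ ~ D j, ~ D (col (f (e j))) & col (f (e j)) <> j])
    (finf : ~ infinite_set [set j | ~ D j /\ col (f (e j)) = j]) :
    infinite_set [set j | ~ D j /\ D (col (f (e j)))].
  move=> F; move/contrapT: finf => F'; apply: Dinf.
  have := conj F F'; rewrite -finite_setU; apply: sub_finite_set => j Dj.
  have [?|?] := pselect (D (col (f (e j)))); first by left.
  by right; split => //; apply: contrapT => ?; apply: nof; exists j.
have [j [Dj Dgj]] := infinite_setN0 (out g no fin).
have [k [[Dk Dgk] kj]] :=
  infinite_setN0 (infinite_setD (out g' no' fin') (finite_set1 j)).
by apply: (settle_out mc Dinf g'g _ Dj Dk Dgj Dgk) => jk; apply: kj.
Qed.

Lemma diagonal_columns (g g' : nat -> nat -> nat) :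
  (forall n, cancel (g n) (g' n)) -> (forall n, cancel (g' n) (g n)) ->
  exists c, [/\ forall j, dmeasurable (c j), c 0 = cst ord0 &
    forall n y y', (forall x, coded c y' x = coded c y (g n x)) ->
      exists x, y' = A x y \/ y = A x y'].
Proof.
move=> gg' g'g.
pose inv (p : set nat * (nat -> Y -> 'I_3)) :=
  (forall j, dmeasurable (p.2 j)) /\ infinite_set (~` p.1).
have step n p : exists p' : set nat * (nat -> Y -> 'I_3), inv p ->
    [/\ inv p', p.1 `<=` p'.1, forall j, p.1 j -> p'.2 j = p.2 j &
      settled p'.1 p'.2 (g n)].
  have [[mc Dinf]|] := pselect (inv p); last by exists p.
  have [D' [c' [? ? ? ? ?]]] := settle mc Dinf (gg' n) (g'g n).
  by exists (D', c').
have [F FP] : {F | forall n p, inv p ->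
    [/\ inv (F n p), p.1 `<=` (F n p).1, forall j, p.1 j -> (F n p).2 j = p.2 j &
      settled (F n p).1 (F n p).2 (g n)]}.
  have [F FP] := choice (fun np => step np.1 np.2).
  by exists (fun n p => F (n, p)) => n p; exact: (FP (n, p)).
(* Column [0], reserved for the position that the toggles fix, is made constant from the start. *)
pose st := nat_rect _ ([set 0], fun=> cst ord0) F.
have st_inv n : inv (st n).
  elim: n => [|n ih]; last by have [] := FP n _ ih.
  split=> [j|]; first exact: dmeasurable_cst.
  by rewrite /= -setTD; apply: infinite_setD => //; exact: infinite_nat.
have st_mono m n j : m <= n -> (st m).1 j -> (st n).1 j /\ (st n).2 j = (st m).2 j.
  elim: n => [|n ih]; first by rewrite leqn0 => /eqP ->.
  rewrite leq_eqVlt => /orP[/eqP ->//|mn] /(ih mn) [Dj cj].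
  have [_ H1 H2 _] := FP n _ (st_inv n).
  by split; [exact: H1|rewrite H2].
(* A settled column never changes again, so any stage at which it is settled gives its value; a
   column never settled is constant. *)
pose c j := if pselect (exists n, (st n).1 j) is left ex
  then (st (projT1 (cid ex))).2 j else cst ord0.
have cE n j : (st n).1 j -> c j = (st n).2 j.
  move=> Dj; rewrite /c; case: pselect => [ex|[]]; last by exists n.
  case: cid => m /= Dmj; case: (leqP m n) => [mn|/ltnW nm].
    by have [] := st_mono _ _ _ mn Dmj.
  by have [] := st_mono _ _ _ nm Dj.
exists c; split.
- move=> j; rewrite /c; case: pselect => [ex|_]; last exact: dmeasurable_cst.
  by have [+ _] := st_inv (projT1 (cid ex)); exact.
- exact: (cE 0).
- move=> n; have [_ _ _] := FP n _ (st_inv n); apply => j Dj.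
  exact: (cE n.+1).
Qed.

End diagonalization.

(** * Analytic sets *)

Definition agree (T : Type) n (w w' : nat -> T) : Prop :=
  forall i, i < n -> w i = w' i.

Lemma agree_sym T n (w w' : nat -> T) : agree n w w' -> agree n w' w.
Proof. by move=> ww' i /ww'. Qed.

Lemma agree_trans T n (w1 w2 w3 : nat -> T) :
  agree n w1 w2 -> agree n w2 w3 -> agree n w1 w3.
Proof. by move=> w12 w23 i ni; rewrite w12 // w23. Qed.

Lemma agree_leq T m n (w w' : nat -> T) : m <= n -> agree n w w' -> agree m w w'.
Proof. by move=> mn ww' i im; apply: ww'; exact: leq_trans mn. Qed.

Lemma agree_limit T (f : nat -> nat -> T) :
  (forall n, agree n (f n) (f n.+1)) -> exists w, forall n, agree n w (f n).
Proof.
move=> ff; exists (fun i => f i.+1 i) => n i; elim: n => // n ih.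
by rewrite ltnS leq_eqVlt => /orP[/eqP ->//|ni]; rewrite ih // ff.
Qed.

Lemma dependent_choice T (P : nat -> T -> Prop) (R : nat -> T -> T -> Prop) x0 :
  P 0 x0 -> (forall n x, P n x -> exists2 y, P n.+1 y & R n x y) ->
  exists f : nat -> T, [/\ f 0 = x0, forall n, P n (f n) &
    forall n, R n (f n) (f n.+1)].
Proof.
move=> P0 step.
have [F FP] : {F | forall n x, P n x -> P n.+1 (F n x) /\ R n x (F n x)}.
  have ex (a : nat * T) : exists y, P a.1 a.2 -> P a.1.+1 y /\ R a.1 a.2 y.
    have [/step[y ? ?]|no] := pselect (P a.1 a.2); first by exists y.
    by exists a.2.
  have [F FP] := choice ex.
  by exists (fun n x => F (n, x)) => n x; exact: (FP (n, x)).
have Pf n : P n (nat_rect (fun=> T) x0 F n) by elim: n => //= n /FP[].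
by exists (nat_rect (fun=> T) x0 F); split => // n; have [] := FP n _ (Pf n).
Qed.

Definition baire := nat -> nat.

Definition cylinders : set (set baire) :=
  [set B | exists n k, B = [set x | x n = k]].

Definition borel_baire := g_sigma_algebraType cylinders.

Lemma measurable_cylinder n k : measurable [set x : borel_baire | x n = k].
Proof. by apply: sub_sigma_algebra; exists n, k. Qed.

Lemma dmeasurable_coord n : dmeasurable (fun x : borel_baire => x n).
Proof. by move=> k; exact: measurable_cylinder. Qed.

Lemma measurable_baireP d (T : measurableType d) (f : T -> borel_baire) :
  measurable_fun setT f <-> forall n, dmeasurable (fun t => f t n).
Proof.
split=> [mf n k|mf].
  by have := mf measurableT _ (measurable_cylinder n k); rewrite setTI.
apply: (@measurability _ _ _ _ setT f cylinders) => //.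
move=> _ [B [n [k ->]] <-]; rewrite setTI; exact: mf.
Qed.

Lemma measurable_baire_eq d (T : measurableType d) (f g : T -> borel_baire) :
  measurable_fun setT f -> measurable_fun setT g ->
  measurable [set t | f t = g t].
Proof.
move=> /measurable_baireP mf /measurable_baireP mg.
rewrite (_ : [set _ | _] = \bigcap_n
    ((fun t => f t n == g t n) @^-1` [set true])).
  by apply: bigcapT_measurable => n; apply: (dmeasurable2 eq_op).
apply/seteqP; split => t /=; first by move=> E n _; rewrite /= E eqxx.
by move=> E; apply/funext => n; apply/eqP; exact: (E n I).
Qed.

Section analytic.
Implicit Types P Q K : set baire.

Definition closed_set K : Prop :=
  forall z, (forall n, exists2 z', K z' & agree n z' z) -> K z.

Definition slice (k : nat) (z : baire) : baire := fun i => z (pickle (k, i)).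

Definition unslice (f : nat -> baire) : baire :=
  fun n => if unpickle n is Some (k, i) then f k i else 0.

(** A pairing, read back by the slices [0] and [1]; it is not onto, since all later slices repeat
    [y]. *)
Definition join (x y : baire) : baire :=
  unslice (fun k => if k is 0 then x else y).

Definition analytic P : Prop :=
  exists2 K, closed_set K & forall z, P z <-> exists q, K (join z q).

(** Continuity for the product topology. *)
Definition local (F : baire -> baire) : Prop :=
  forall z n, exists m, forall z', agree m z' z -> agree n (F z') (F z).

Lemma slice_unslice f k : slice k (unslice f) = f k.
Proof. by apply/funext => i; rewrite /slice /unslice pickleK. Qed.

Lemma slice0_join x y : slice 0 (join x y) = x.
Proof. exact: slice_unslice. Qed.

Lemma slice1_join x y : slice 1 (join x y) = y.
Proof. exact: slice_unslice. Qed.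

Lemma local_comp F G : local F -> local G -> local (F \o G).
Proof.
move=> lF lG z n; have [m mP] := lF (G z) n; have [l lP] := lG z m.
by exists l => z' /lP/mP.
Qed.

Lemma local_coord (F : baire -> baire) :
  (forall z i, exists m, forall z', agree m z' z -> F z' i = F z i) -> local F.
Proof.
move=> ls z; elim=> [|n [m mP]]; first by exists 0.
have [l lP] := ls z n; exists (maxn m l) => z' zz' i.
rewrite ltnS leq_eqVlt => /orP[/eqP ->|ni].
  by apply: lP; exact: agree_leq (leq_maxr _ _) zz'.
by apply: mP ni; exact: agree_leq (leq_maxl _ _) zz'.
Qed.

Lemma local_slice k : local (slice k).
Proof.
by apply: local_coord => z i; exists (pickle (k, i)).+1 => z'; apply.
Qed.

Lemma local_join F G : local F -> local G -> local (fun z => join (F z) (G z)).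
Proof.
move=> lF lG; apply: local_coord => z n.
rewrite /join /unslice; case: unpickle => [[[|k] i]|]; last by exists 0.
  by have [m mP] := lF z i.+1; exists m => z' /mP; apply.
by have [m mP] := lG z i.+1; exists m => z' /mP; apply.
Qed.

(** Unlike in [local], the modulus does not depend on the points; the limit argument for analytic
    separation needs this. *)
Lemma agree_join n : exists m, forall x x' y y', agree m x' x -> agree m y' y ->
  agree n (join x' y') (join x y).
Proof.
elim: n => [|n [m mP]]; first by exists 0.
pose l := if unpickle n is Some (k, i) then ((k : nat, i).2 : nat).+1 else 0.
exists (maxn m l) => x x' y y' xx' yy' i.
rewrite ltnS leq_eqVlt => /orP[/eqP ->|]; last first.
  by apply: mP; [exact: agree_leq (leq_maxl _ _) xx'|
    exact: agree_leq (leq_maxl _ _) yy'].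
rewrite /join /unslice /l in xx' yy' *.
case: (unpickle n) xx' yy' => [[[|k] j]|] // xx' yy'.
  by apply: xx'; rewrite leq_maxr.
by apply: yy'; rewrite leq_maxr.
Qed.

Lemma closed_preimage K F : closed_set K -> local F -> closed_set (K \o F).
Proof.
move=> cK lF z zP; apply: cK => n.
have [m mP] := lF z n; have [z' Pz' zz'] := zP m.
by exists (F z') => //; exact: mP.
Qed.

Lemma closed_forall (I : Type) (K : I -> set baire) :
  (forall i, closed_set (K i)) -> closed_set (fun z => forall i, K i z).
Proof.
move=> cK z zP i; apply: cK => n; have [z' Kz' zz'] := zP n.
by exists z'.
Qed.

Lemma closed_setI K K' : closed_set K -> closed_set K' ->
  closed_set (fun z => K z /\ K' z).
Proof.
move=> cK cK' z zP; split; [apply: cK|apply: cK'] => n;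
  by have [z' [Kz' Kz'' ]] := zP n; exists z'.
Qed.

Lemma closed_coord (n : nat) (S : set nat) : closed_set (fun z => S (z n)).
Proof.
by move=> z zP; have [z' + <-] := zP n.+1.
Qed.

Lemma closed_eq F G : local F -> local G -> closed_set (fun z => F z = G z).
Proof.
move=> lF lG z zP; apply/funext => i.
have [m mP] := lF z i.+1; have [l lP] := lG z i.+1.
have [z' E zz'] := zP (maxn m l).
rewrite -(mP z') // ?E; last exact: agree_leq (leq_maxl _ _) zz'.
by apply: lP => //; exact: agree_leq (leq_maxr _ _) zz'.
Qed.

Lemma analytic_closed K : closed_set K -> analytic K.
Proof.
move=> cK; exists (K \o slice 0).
  exact: closed_preimage (local_slice 0).
by move=> z; split=> [Kz|[q]]; [exists z|]; rewrite /= slice0_join.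
Qed.

Lemma analytic_preimage P F : analytic P -> local F -> analytic (P \o F).
Proof.
move=> [K cK KP] lF.
exists (K \o (fun u => join (F (slice 0 u)) (slice 1 u))).
  apply: closed_preimage => //; apply: local_join; last exact: local_slice.
  exact: local_comp (local_slice 0).
by move=> z; rewrite [(P \o F) z]/=; split=> [/KP|] [q Kq];
  [exists q|apply/KP; exists q]; move: Kq; rewrite /= slice0_join slice1_join.
Qed.

Lemma analytic_bigcap (P : nat -> set baire) : (forall n, analytic (P n)) ->
  analytic (fun z => forall n, P n z).
Proof.
move=> aP; have [K KP] : {K | forall n, closed_set (K n) /\
    forall z, P n z <-> exists q, K n (join z q)}.
  by exists (fun n => projT1 (cid2 (aP n))) => n; case: cid2.
exists (fun u => forall n, K n (join (slice 0 u) (slice n (slice 1 u)))).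
  apply: closed_forall => n; apply: (@closed_preimage (K n)).
    by have [] := KP n.
  apply: local_join; first exact: local_slice.
  exact: local_comp (local_slice n) (local_slice 1).
move=> z; split=> [Pz|[q Kq] n]; last first.
  have [_ ->] := KP n; exists (slice n q).
  by have := Kq n; rewrite slice0_join slice1_join.
have /choice[q qP] n : exists p, K n (join z p).
  by have [_ /(_ z)[+ _]] := KP n; apply.
exists (unslice q) => n.
by rewrite slice0_join slice1_join slice_unslice.
Qed.

Lemma analytic_exists P : analytic P ->
  analytic (fun z => exists w, P (join z w)).
Proof.
move=> [K cK KP].
exists (K \o (fun u => join (join (slice 0 u) (slice 0 (slice 1 u)))
                            (slice 1 (slice 1 u)))).
  apply: closed_preimage => //; apply: local_join; last first.
    exact: local_comp (local_slice 1) (local_slice 1).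
  apply: local_join; first exact: local_slice.
  exact: local_comp (local_slice 0) (local_slice 1).
move=> z; split=> [[w /KP[q Kq]]|[q Kq]].
  by exists (join w q); rewrite /= !(slice0_join, slice1_join).
exists (slice 0 q); apply/KP; exists (slice 1 q).
by move: Kq; rewrite /= !(slice0_join, slice1_join).
Qed.

(** The union is [exists w, forall m, w 0 = m -> P m z], which reduces it to projections and
    countable intersections. *)
Lemma analytic_bigcup (P : nat -> set baire) : (forall n, analytic (P n)) ->
  analytic (\bigcup_n P n).
Proof.
move=> aP.
pose S n : set baire := fun u => slice 1 u 0 = n -> P n (slice 0 u).
have aS n : analytic (S n).
  have [K cK KP] := aP n.
  exists (fun u => slice 1 (slice 0 u) 0 = n ->
      K (join (slice 0 (slice 0 u)) (slice 1 u))).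
    move=> u uP /= E; apply: (closed_preimage cK (F := fun u =>
      join (slice 0 (slice 0 u)) (slice 1 u))).
      apply: local_join; last exact: local_slice.
      exact: local_comp (local_slice 0) (local_slice 0).
    move=> k.
    have [l lP] := local_comp (local_slice 1) (local_slice 0) u 1.
    have [u' Ku' uu'] := uP (maxn k l); exists u'.
      apply: Ku'; rewrite -E; apply: (lP u') => //.
      exact: agree_leq (leq_maxr _ _) uu'.
    exact: agree_leq (leq_maxl _ _) uu'.
  move=> u; split=> [Su|[q Kq] E].
    have [/Su/KP[q Kq]|no] := pselect (slice 1 u 0 = n).
      by exists q; rewrite !(slice0_join, slice1_join).
    by exists u; rewrite !(slice0_join, slice1_join).
  apply/KP; exists q.
  by move: Kq; rewrite !(slice0_join, slice1_join); apply.
have := analytic_exists (analytic_bigcap aS); congr analytic.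
apply/seteqP; split => [z [w zw]|z [n _ Pz]].
  exists (w 0) => //; have := zw (w 0).
  by rewrite /S slice1_join slice0_join; apply.
by exists (fun=> n) => m; rewrite /S slice1_join slice0_join => <-.
Qed.

(** The sets that are analytic together with their complements form a sigma-algebra containing the
    cylinders. *)
Lemma measurable_analytic (B : set borel_baire) : measurable B -> analytic B.
Proof.
pose G : set (set baire) := [set B | analytic B /\ analytic (~` B)].
suff GB (B' : set borel_baire) : measurable B' -> G B' by move=> /GB[].
apply: smallest_sub B'; last first.
  move=> _ [n [k ->]]; split; apply: analytic_closed.
    exact: (@closed_coord n [set k]).
  exact: (@closed_coord n (~` [set k])).
split.
- split; first by apply: analytic_closed => z /(_ 0)[].
  by rewrite setC0; apply: analytic_closed => z _.
- by move=> B' [? ?]; rewrite setTD; split => //; rewrite setCK.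
- move=> F GF; split; first by apply: analytic_bigcup => n; have [] := GF n.
  have := analytic_bigcap (fun n => proj2 (GF n)); congr analytic.
  by apply/seteqP; split => [z Fz [n _ /(Fz n)]|z Fz n Fnz]; [|apply: Fz; exists n].
Qed.

(** * Lusin separation of disjoint analytic sets *)

Definition separated P Q : Prop := exists B : set borel_baire,
  [/\ measurable B, P `<=` B & forall z, B z -> ~ Q z].

Lemma separated_bigcup (I J : countType) (P : I -> set baire) (Q : J -> set baire) :
  (forall i j, separated (P i) (Q j)) ->
  separated (\bigcup_i P i) (\bigcup_j Q j).
Proof.
move=> PQ; have [B BP] := choice (fun ij : I * J => PQ ij.1 ij.2).
exists (\bigcup_i \bigcap_j B (i, j)); split.
- apply: countable_bigcupT_measurable => [|i]; first exact: countableP.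
  rewrite -[X in measurable X]setCK setC_bigcap; apply: measurableC.
  apply: countable_bigcupT_measurable => [|j]; first exact: countableP.
  by apply: measurableC; have [] := BP (i, j).
- by move=> z [i _ Pz]; exists i => // j _; have [_ H _] := BP (i, j); exact: H.
- move=> z [i _ Bz] [j _ Qz]; have [_ _ H] := BP (i, j).
  exact: (H z (Bz j Logic.I) Qz).
Qed.

(** If [P] and [Q] are not separated, [separated_bigcup] yields ever smaller inseparable pieces,
    given by initial segments of points and witnesses. The limits lie in [K] and [L]; their first
    coordinates agree, since a cylinder would otherwise separate some pieces, and so [P] meets
    [Q]. *)
Lemma analytic_separation P Q : analytic P -> analytic Q ->
  (forall z, P z -> ~ Q z) -> separated P Q.
Proof.
move=> [K cK KP] [L cL LQ] PQ.
pose part (M : set baire) n (z q : baire) : set baire :=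
  fun x => exists2 p, M (join x p) & agree n x z /\ agree n p q.
pose set_at n (z : baire) k : baire := fun i => if i == n then k else z i.
have agree_set n z k : agree n z (set_at n z k).
  by move=> i ni; rewrite /set_at ltn_eqF.
have part_step M n z q : part M n z q =
    \bigcup_(a : nat * nat) part M n.+1 (set_at n z a.1) (set_at n q a.2).
  apply/seteqP; split => [x [p Mp [xz pq]]|x [a _ [p Mp [xz pq]]]].
    exists (x n, p n) => //; exists p => //; split => i.
      by rewrite /set_at ltnS leq_eqVlt; case: eqP => [->//|_ /=]; exact: xz.
    by rewrite /set_at ltnS leq_eqVlt; case: eqP => [->//|_ /=]; exact: pq.
  exists p => //; split; apply: agree_trans (agree_sym (agree_set n _ _)).
    exact: agree_leq xz.
  exact: agree_leq pq.
apply: contrapT => nsep.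
pose S (a : nat -> nat * nat) n (M : set baire) :=
  part M n (fun i => (a i).1) (fun i => (a i).2).
pose bad n (ab : (nat -> nat * nat) * (nat -> nat * nat)) :=
  ~ separated (S ab.1 n K) (S ab.2 n L).
have bad0 : bad 0 (fun=> (0, 0), fun=> (0, 0)).
  apply: contra_not nsep; congr separated; apply/seteqP; split => x.
  - by move=> [p Kp _]; apply/KP; exists p.
  - by move=> /KP[p Kp]; exists p.
  - by move=> [p Kp _]; apply/LQ; exists p.
  - by move=> /LQ[p Kp]; exists p.
have [|f [_ fbad fagree]] := dependent_choice
    (R := fun n a b => agree n a.1 b.1 /\ agree n a.2 b.2) bad0.
  move=> n [a b] nab.
  have /existsNP[u /existsNP[v uv]] : ~ forall u v : nat * nat, separated
      (part K n.+1 (set_at n (fst \o a) u.1) (set_at n (snd \o a) u.2))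
      (part L n.+1 (set_at n (fst \o b) v.1) (set_at n (snd \o b) v.2)).
    by move=> /separated_bigcup; rewrite -!part_step.
  pose up (a : nat -> nat * nat) u i := if i == n then u else a i.
  exists (up a u, up b v); last first.
    by split => i ni; rewrite /up /= ltn_eqF.
  move: uv; congr (~ separated (part _ _ _ _) (part _ _ _ _));
    by apply/funext => i; rewrite /set_at /up /=; case: ifP.
have [a aP] := agree_limit (fun n => proj1 (fagree n)).
have [b bP] := agree_limit (fun n => proj2 (fagree n)).
have limit M (c : nat -> nat * nat) (cn : nat -> nat -> nat * nat) :
    (forall n, agree n c (cn n)) -> closed_set M ->
    (forall n, exists x, S (cn n) n M x) -> M (join (fst \o c) (snd \o c)).
  move=> ccn cM ne; apply: cM => n; have [m mP] := agree_join n.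
  have [x [p Mp [xz pq]]] := ne m; exists (join x p) => //.
  apply: mP => i im; first by rewrite xz //= (ccn m).
  by rewrite pq //= (ccn m).
have Ka : K (join (fst \o a) (snd \o a)).
  apply: (limit _ _ _ aP cK) => n; apply: contrapT => no; apply: (fbad n).
  exists set0; split; [exact: measurable0| |by []].
  by move=> x Sx; apply: no; exists x.
have Lb : L (join (fst \o b) (snd \o b)).
  apply: (limit _ _ _ bP cL) => n; apply: contrapT => no; apply: (fbad n).
  exists setT; split; [exact: measurableT|by []|].
  by move=> x _ Sx; apply: no; exists x.
have ab : fst \o a = fst \o b.
  apply/funext => i; apply: contrapT => abi; apply: (fbad i.+1).
  exists [set x : borel_baire | x i = (a i).1]; split.
  - exact: measurable_cylinder.
  - by move=> x [p _ [xa _]] /=; rewrite xa //= (aP i.+1).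
  - move=> x /= xa [p _ [xb _]]; apply: abi.
    by rewrite /= -xa xb //= (bP i.+1).
apply: (PQ (fst \o a)); first by apply/KP; exists (snd \o a).
by apply/LQ; exists (snd \o b); rewrite ab.
Qed.

End analytic.

(** * The Lusin-Novikov theorem *)

Lemma measurable_slice k :
  measurable_fun setT (slice k : borel_baire -> borel_baire).
Proof. by apply/measurable_baireP => n; exact: dmeasurable_coord. Qed.

Lemma analytic_setI (P Q : set baire) : analytic P -> analytic Q ->
  analytic (fun z => P z /\ Q z).
Proof.
move=> aP aQ.
have aPQ n : analytic (if n is 0 then P else Q) by case: n.
have := analytic_bigcap aPQ; congr analytic; apply/seteqP; split => z.
  by move=> PQz; split; [exact: (PQz 0)|exact: (PQz 1)].
by move=> [Pz Qz] [].
Qed.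

(** A partial function whose coordinates have analytic level sets extends to a total Borel map:
    Borel sets [B] separate the level sets pairwise, and [h x n] is the least [k] for which [x] is
    on the side of [k] against every [k']. *)
Lemma measurable_graph_cover (G : nat -> nat -> set baire) :
  (forall n k, analytic (G n k)) ->
  (forall x n k k', G n k x -> G n k' x -> k = k') ->
  exists2 h : borel_baire -> borel_baire, measurable_fun setT h &
    forall x n k, G n k x -> h x n = k.
Proof.
move=> aG uG.
have /choice[B BP] (a : nat * nat * nat) : exists B : set borel_baire,
    measurable B /\ (a.1.2 <> a.2 -> G a.1.1 a.1.2 `<=` B /\
      forall z, B z -> ~ G a.1.1 a.2 z).
  have [E|/eqP N] := eqVneq a.1.2 a.2.
    by exists set0; split => [|[]//]; exact: measurable0.
  have [|B [mB GB BG]] := analytic_separation (aG a.1.1 a.1.2) (aG a.1.1 a.2).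
    by move=> z Gz Gz'; apply: N; exact: uG Gz Gz'.
  by exists B.
pose p n k x := `[< forall k', k <> k' -> B (n, k, k') x >].
exists (fun x n => least (p n ^~ x)).
  apply/measurable_baireP => n; apply: dmeasurable_least => k.
  apply: dmeasurable_bool.
  rewrite (_ : [set _ | _] =
      \bigcap_k' (if k == k' then setT else B (n, k, k'))).
    apply: bigcapT_measurable => k'; case: eqP => _; first exact: measurableT.
    by have [] := BP (n, k, k').
  apply/seteqP; split => x /=.
    by move=> /asboolP pk k' _; case: eqP => // /pk.
  by move=> pk; apply/asboolP => k' kk'; have := pk k' Logic.I; case: eqP.
move=> x n k Gx.
have BG k' : p n k' x -> k' = k.
  move=> /asboolP pk'; apply: contrapT => kk'; have [_ H] := BP (n, k', k).
  by have [_ /(_ x (pk' _ kk'))] := H kk'.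
suff pk : p n k x by apply: BG; exact: (@leastP (p n ^~ x) k pk).1.
apply/asboolP => k' kk'.
by have [_ H] := BP (n, k, k'); have [+ _] := H kk'; exact.
Qed.

Section lusin_novikov.
Variable A K : set baire.
Hypothesis K_closed : closed_set K.
Hypothesis AK : forall u, A u <-> exists p, K (join u p).

(* A point [w] of [wit] codes a pair in [A] together with a witness. *)
Let wit : set baire :=
  fun w => K (join (join (slice 0 w) (slice 1 w)) (slice 2 w)).

Let wit_closed : closed_set wit.
Proof.
apply: (closed_preimage (F := fun w =>
  join (join (slice 0 w) (slice 1 w)) (slice 2 w)) K_closed).
apply: local_join; last exact: local_slice.
by apply: local_join; exact: local_slice.
Qed.

Let pre (s : seq nat) (w : baire) := forall i, i < size s -> w i = nth 0 s i.

Let config (a : seq (seq nat)) x (w : nat -> baire) := forall j, j < size a ->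
  [/\ wit (w j), slice 0 (w j) = x & pre (nth [::] a j) (w j)].

Let avoids (H : nat -> baire -> baire) m x (w : nat -> baire) :=
  forall j n, j < m -> slice 1 (w j) <> H n x.

Let meas (H : nat -> baire -> baire) :=
  forall n, measurable_fun setT (H n : borel_baire -> borel_baire).

(* Every [a] is a finite approximation of finitely many points of one section of
   [A]. Good approximations are those whose configurations cannot be destroyed
   by removing countably many Borel graphs from [A]. *)
Let good a := forall H, meas H ->
  exists x w, config a x w /\ avoids H (size a) x w.

Let ext s t := forall w, pre t w -> pre s w.

Let apart s t := forall w w', pre s w -> pre t w' -> slice 1 w <> slice 1 w'.

Let apart_ext s t s' t' : apart s t -> ext s s' -> ext t t' -> apart s' t'.
Proof. by move=> st ss' tt' w w' /ss' sw /tt'; exact: st. Qed.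

Let pre_mkseq w n v : pre (mkseq w n) v -> agree n v w.
Proof. by move=> wv i ni; rewrite wv ?size_mkseq // nth_mkseq. Qed.

Let ext_mkseq s w n : pre s w -> size s <= n -> ext s (mkseq w n).
Proof.
move=> sw sn v /pre_mkseq vw i si.
by rewrite vw; [exact: sw|exact: leq_trans sn].
Qed.

Let split_of a i l a' := [/\ size a' = (size a).+1,
  forall j, j < size a -> ext (nth [::] a j) (nth [::] a' j),
  ext (nth [::] a i) (nth [::] a' (size a)),
  apart (nth [::] a' i) (nth [::] a' (size a)) &
  forall j, j < size a' -> l <= size (nth [::] a' j)].

(** The points of a configuration are coded as slices of one sequence, which is projected away.
    Their closed conditions are analytic, and so is the Borel condition of avoiding the graphs. *)
Let analytic_config a H (n k i : nat) : meas H -> analytic (fun x =>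
  exists w, [/\ config a x w, avoids H (size a) x w & slice 1 (w i) n = k]).
Proof.
move=> mH.
pose F j u := slice j (slice 1 u).
have lF j : local (F j) by exact: local_comp (local_slice j) (local_slice 1).
pose Q j u := [/\ wit (F j u), slice 0 (F j u) = slice 0 u &
  pre (nth [::] a j) (F j u)].
pose Q' j l u := slice 1 (F j u) <> H l (slice 0 u).
have aQ j : analytic (Q j).
  apply: analytic_closed.
  have -> : Q j = (fun u => wit (F j u) /\ slice 0 (F j u) = slice 0 u /\
      forall l, l < size (nth [::] a j) -> F j u l = nth 0 (nth [::] a j) l).
    by apply/seteqP; split => [u [? ? ?]|u [? [? ?]]].
  apply: closed_setI; first exact: closed_preimage wit_closed (lF j).
  apply: closed_setI.
    apply: closed_eq; last exact: local_slice.
    exact: local_comp (local_slice 0) (lF j).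
  apply: (@closed_preimage (fun w => forall l, l < size (nth [::] a j) ->
    w l = nth 0 (nth [::] a j) l) _ _ (lF j)).
  apply: closed_forall => l; apply: closed_forall => _.
  exact: (@closed_coord l [set nth 0 (nth [::] a j) l]).
have aQ' j l : analytic (Q' j l).
  have mN : measurable (~` [set v : borel_baire | slice 1 v = H l (slice 0 v)]).
    apply: measurableC; apply: measurable_baire_eq; first exact: measurable_slice.
    exact: (measurableT_comp (mH l) (measurable_slice 0)).
  have := analytic_preimage (measurable_analytic mN) (local_join (local_slice 0)
    (local_comp (local_slice 1) (lF j))).
  congr analytic; apply/seteqP.
  by split => u; rewrite /Q' /= slice0_join slice1_join.
have aR j : analytic (fun u => j < size a -> Q j u /\ forall l, Q' j l u).
  case: (ltnP j (size a)) => ja; last by apply: analytic_closed => u.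
  have := analytic_setI (aQ j) (analytic_bigcap (aQ' j)); congr analytic.
  by apply/seteqP; split => u //=; apply.
have ak : analytic (fun u => slice 1 (F i u) n = k).
  apply: analytic_closed.
  apply: (closed_preimage (@closed_coord n [set k])
    (local_comp (local_slice 1) (lF i))).
have := analytic_exists (analytic_setI (analytic_bigcap aR) ak); congr analytic.
apply/seteqP; split => [x [w []]|x [w [cw aw wk]]].
  rewrite /Q /Q' /F !slice0_join !slice1_join => Rw wk.
  exists (fun j => slice j w); split => //.
    by move=> j ja; have [] := Rw j ja.
  by move=> j l ja; have [_ /(_ l)] := Rw j ja.
exists (unslice w).
rewrite /Q /Q' /F !slice0_join !slice1_join !slice_unslice; split => // j ja.
by rewrite slice_unslice; split => [|l]; [exact: cw|exact: aw].
Qed.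

(** Otherwise each of the countably many splits of [a] is destroyed by countably many Borel graphs.
    Once all of these are removed, two different choices of the [i]-th point would realize a split;
    so this point is unique, and removing one more Borel graph [h] destroys [a]. *)
Let good_split a i l : good a -> i < size a ->
  exists2 a', good a' & split_of a i l a'.
Proof.
move=> ga ia; apply: contrapT => no.
have /choice[Hf HfP] (a' : seq (seq nat)) : exists H, meas H /\
    (split_of a i l a' -> forall x w, config a' x w -> ~ avoids H (size a') x w).
  have [sa'|] := pselect (split_of a i l a'); last first.
    by exists (fun=> id); split => // n; exact: measurable_id.
  have /existsNP[H /not_implyP[mH noH]] : ~ good a'.
    by move=> ga'; apply: no; exists a'.
  by exists H; split => // _ x w cw aw; apply: noH; exists x, w.
pose H n := if unpickle n is Some (a', k) then Hf a' k else id.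
have mH : meas H.
  move=> n; rewrite /H; case: unpickle => [[a' k]|]; last exact: measurable_id.
  by have [] := HfP a'.
have uniq x w w' : config a x w -> avoids H (size a) x w ->
    config a x w' -> avoids H (size a) x w' -> slice 1 (w i) = slice 1 (w' i).
  move=> cw aw cw' aw'; apply: contrapT => ww'.
  have [n wn] : exists n, slice 1 (w i) n <> slice 1 (w' i) n.
    by apply: contrapT => E; apply: ww'; apply/funext => n; apply: contrapT => ?;
      apply: E; exists n.
  (* Long enough to extend all of [a], to meet the bound [l] and to show coordinate [n] of slice
     [1], where the two points differ. *)
  pose L := maxn (\max_(s <- a) size s) (maxn l (pickle (1, n)).+1).
  have lL : l <= L by rewrite /L !leq_max leqnn /= orbT.
  have nL : pickle (1, n) < L by rewrite /L !leq_max leqnn /= !orbT.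
  have sL j : j < size a -> size (nth [::] a j) <= L.
    move=> ja; rewrite /L leq_max; apply/orP; left.
    by apply: (@leq_bigmax_seq _ _ xpredT size) => //; exact: mem_nth.
  pose v j := if j == size a then w' i else w j.
  pose a' := mkseq (fun j => mkseq (v j) L) (size a).+1.
  have va j : j < size a -> v j = w j.
    by rewrite /v; case: eqP => // ->; rewrite ltnn.
  have a'E j : j < (size a).+1 -> nth [::] a' j = mkseq (v j) L.
    by move=> ja; rewrite nth_mkseq.
  have sa' : split_of a i l a'.
    split; first by rewrite size_mkseq.
    - move=> j ja; rewrite a'E; last exact: ltnW.
      by apply: ext_mkseq; [rewrite va //; have [] := cw j ja|exact: sL].
    - rewrite a'E //; apply: ext_mkseq; last exact: sL.
      by rewrite /v eqxx; have [] := cw' i ia.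
    - rewrite !a'E //; last exact: ltnW.
      move=> z z' /pre_mkseq zv /pre_mkseq zv' E; apply: wn.
      have := congr1 (@^~ n) E; rewrite /slice zv // zv' //.
      by rewrite (va _ ia) /v eqxx.
    - by move=> j; rewrite size_mkseq => ja; rewrite a'E // size_mkseq.
  have [_ /(_ sa' x v)] := HfP a'; apply.
  - move=> j; rewrite size_mkseq => ja; rewrite a'E //.
    have vj : wit (v j) /\ slice 0 (v j) = x.
      by rewrite /v; case: eqP => [_|/eqP jN]; [have [] := cw' i ia|
        have [] := cw j; rewrite // ltn_neqAle jN -ltnS].
    by case: vj => ? ?; split => // k; rewrite size_mkseq => kL; rewrite nth_mkseq.
  - have HE j k : H (pickle (a' , k)) j = Hf a' k j by rewrite /H pickleK.
    move=> j k; rewrite size_mkseq => ja; rewrite -HE.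
    rewrite /v; case: eqP => [_|/eqP jN]; first exact: aw'.
    by apply: aw; rewrite ltn_neqAle jN -ltnS.
have [h mh hP] : exists2 h : borel_baire -> borel_baire, measurable_fun setT h &
    forall x n k, (exists w, [/\ config a x w, avoids H (size a) x w &
      slice 1 (w i) n = k]) -> h x n = k.
  apply: (measurable_graph_cover (G := fun n k x => exists w,
    [/\ config a x w, avoids H (size a) x w & slice 1 (w i) n = k])).
    by move=> n k; exact: analytic_config.
  by move=> x n k k' [w [cw aw <-]] [w' [cw' aw' <-]]; rewrite (uniq x w w').
have [|x [w [cw aw]]] := ga (fun n => if n is n'.+1 then H n' else h).
  by case.
apply: (aw i 0 ia); apply/funext => n; apply/esym; apply: hP.
by exists w; split => // j k ja; exact: (aw j k.+1 ja).
Qed.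

Let double_of a l a' := [/\ size a' = size a + size a,
  forall j, j < size a -> ext (nth [::] a j) (nth [::] a' j),
  forall j, j < size a -> ext (nth [::] a j) (nth [::] a' (size a + j)),
  forall j, j < size a -> apart (nth [::] a' j) (nth [::] a' (size a + j)) &
  forall j, j < size a' -> l <= size (nth [::] a' j)].

(** The entries are split one after the other, the partner of [j] landing at [size a + j]. The bound
    on the lengths comes from the last split, hence the condition [0 < i] in the induction. *)
Let good_double a l : good a -> 0 < size a ->
  exists2 a', good a' & double_of a l a'.
Proof.
move=> ga a0.
suff H i : i <= size a -> exists2 a', good a' & [/\ size a' = size a + i,
    forall j, j < size a -> ext (nth [::] a j) (nth [::] a' j),
    forall j, j < i -> ext (nth [::] a j) (nth [::] a' (size a + j)),
    forall j, j < i -> apart (nth [::] a' j) (nth [::] a' (size a + j)) &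
    0 < i -> forall j, j < size a' -> l <= size (nth [::] a' j)].
  have [a' ga' [H1 H2 H3 H4 /(_ a0) H5]] := H _ (leqnn (size a)).
  by exists a' => //; split.
elim: i => [_|i ih ia]; first by exists a => //; split; rewrite ?addn0 // => j _ w.
have [b gb [sb b1 b2 b3 _]] := ih (ltnW ia).
have ib : i < size b by rewrite sb ltn_addr.
have [c gc [sc c1 c2 c3 c4]] := good_split l gb ib.
exists c => //; split => //.
- by rewrite sc sb addnS.
- by move=> j ja w cw; apply: (b1 j) => //; apply: c1 => //; rewrite sb ltn_addr.
- move=> j; rewrite ltnS leq_eqVlt => /orP[/eqP ->|ji] w.
    by rewrite -sb => cw; apply: b1 => //; exact: c2.
  by move=> cw; apply: (b2 j) => //; apply: c1 => //; rewrite sb ltn_add2l.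
- move=> j; rewrite ltnS leq_eqVlt => /orP[/eqP ->|ji]; first by rewrite -sb.
  apply: apart_ext (b3 j ji) _ _; apply: c1; rewrite sb ?ltn_add2l //.
  by rewrite ltn_addr // (ltn_trans ji).
Qed.

(** The number with binary digits [b 0, ..., b (k - 1)]: the place of the branch [b] in the list of
    level [k] obtained by repeated doubling. *)
Let index (b : nat -> bool) k := \sum_(i < k) b i * 2 ^ i.

Let index_lt b k : index b k < 2 ^ k.
Proof.
elim: k => [|k ih]; first by rewrite /index big_ord0.
rewrite /index big_ord_recr /= expnS mul2n -addnn -addSn leq_add //.
by case: (b k); rewrite ?mul1n ?mul0n.
Qed.

(** Repeated doubling builds a Cantor scheme. Its branches converge to points of [wit] over one [x],
    and different branches give different second coordinates. *)
Let uncountable_section : good [:: [::]] -> exists x,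
  ~ countable [set y | A (join x y)].
Proof.
move=> g0.
have [|f [f0 fP fR]] := dependent_choice (x0 := [:: [::]])
    (P := fun n a => good a /\ size a = 2 ^ n)
    (R := fun n a a' => double_of a n.+1 a') (conj g0 erefl).
  move=> n a [ga sa]; have [|a' ga' a'a] := good_double n.+1 ga.
    by rewrite sa expn_gt0.
  exists a' => //; split => //; have [-> _ _ _ _] := a'a.
  by rewrite sa expnS mul2n addnn.
have sf n : size (f n) = 2 ^ n by have [] := fP n.
pose s b k := nth [::] (f k) (index b k).
have size_s b k : k <= size (s b k).
  case: k => // k; have [_ _ _ _] := fR k; apply; rewrite sf; exact: index_lt.
have indexS b k : index b k.+1 = index b k + b k * 2 ^ k.
  by rewrite /index big_ord_recr.
have ext_s b k : ext (s b k) (s b k.+1).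
  have [_ H1 H2 _ _] := fR k; rewrite /s indexS.
  have lt : index b k < size (f k) by rewrite sf.
  case: (b k); rewrite ?mul0n ?addn0; last exact: H1.
  by rewrite mul1n addnC -sf; exact: H2.
have nth_s b k k' i : k <= k' -> i < size (s b k) ->
    nth 0 (s b k') i = nth 0 (s b k) i.
  elim: k' => [|k' ih]; first by rewrite leqn0 => /eqP ->.
  rewrite leq_eqVlt => /orP[/eqP ->//|kk'] ik.
  have E m : k <= m -> ext (s b k) (s b m).
    elim: m => [|m ihm]; first by rewrite leqn0 => /eqP -> w.
    rewrite leq_eqVlt => /orP[/eqP -> w//|km] w /ext_s; exact: ihm.
  by apply: (E _ (ltnW kk') (nth 0 (s b k'.+1))).
pose lim b : baire := fun i => nth 0 (s b i.+1) i.
have pre_lim b k : pre (s b k) (lim b).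
  move=> i ik; rewrite /lim -(@nth_s b k (maxn k i.+1)) ?leq_maxl //.
  by rewrite (@nth_s b i.+1) ?leq_maxr.
(* Goodness of [f n], used with arbitrary graphs, supplies one configuration for all branches, so
   the points near [lim b] and [lim b'] share their first coordinate. *)
have approx b b' n : exists w w', [/\ wit w, slice 0 w = slice 0 w',
    agree n w (lim b) & agree n w' (lim b')].
  have [gf _] := fP n; have [|x [w [cw _]]] := gf (fun=> id).
    by move=> m; exact: measurable_id.
  exists (w (index b n)), (w (index b' n)).
  have lt c : index c n < size (f n) by rewrite sf.
  have [w1 w2 w3] := cw _ (lt b); have [w1' w2' w3'] := cw _ (lt b').
  split; rewrite ?w2 ?w2' // => i ni.
    by rewrite (pre_lim b n) ?w3 //; exact: leq_trans ni (size_s _ _).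
  by rewrite (pre_lim b' n) ?w3' //; exact: leq_trans ni (size_s _ _).
have wit_lim b : wit (lim b).
  by apply: wit_closed => n; have [w [w' [? _ ? _]]] := approx b b n; exists w.
pose x := slice 0 (lim (fun=> false)).
have xE b : slice 0 (lim b) = x.
  apply/funext => i.
  have [w [w' [_ ww' wb w'b]]] := approx b (fun=> false) (pickle (0, i)).+1.
  by rewrite /x /slice -wb // -w'b //; exact: (congr1 (@^~ i) ww').
exists x => /countable_injP[e e_inj].
have Ax b : A (join x (slice 1 (lim b))).
  by apply/AK; exists (slice 2 (lim b)); rewrite -(xE b); exact: wit_lim.
have lim_inj b b' : slice 1 (lim b) = slice 1 (lim b') -> b = b'.
  move=> E; suff H k : forall i, i < k -> b i = b' i.
    by apply/funext => i; exact: (H i.+1).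
  (* Branches agreeing below [k] have the same index at level [k]; if they differ at [k], they
     continue in the two apart halves. *)
  elim: k => // k ih i; rewrite ltnS leq_eqVlt => /orP[/eqP ->|/ih//].
  have ij : index b k = index b' k.
    by apply: eq_bigr => j _; rewrite ih.
  have [_ _ _ /(_ (index b k)) H _] := fR k.
  have {}H : apart (nth [::] (f k.+1) (index b k))
      (nth [::] (f k.+1) (size (f k) + index b k)) by apply: H; rewrite sf.
  have := pre_lim b k.+1; have := pre_lim b' k.+1; rewrite /s !indexS -ij.
  case: (b k) (b' k) => -[] //; rewrite mul1n mul0n addn0 addnC -sf => p1 p2.
    by have := H _ _ p1 p2; rewrite E.
  by have := H _ _ p2 p1; rewrite E.
pose phi b := e (slice 1 (lim b)).
have phi_inj b b' : phi b = phi b' -> b = b'.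
  by move=> E; apply: lim_inj; apply: e_inj; rewrite ?inE.
(* Cantor's diagonal: [diag] differs at the number [phi b] from [b], for every [b]. *)
pose diag n := if pselect (exists b, phi b = n) is left ex
  then ~~ projT1 (cid ex) n else true.
have := erefl (diag (phi diag)); rewrite {1}/diag.
case: pselect => [ex|[]]; last by exists diag.
by case: cid => b /= /phi_inj ->; case: (diag _).
Qed.

(** With countable sections the single empty approximation is not good, and the graphs that destroy
    it cover [A]. *)
Lemma lusin_novikov_closed : (forall x, countable [set y | A (join x y)]) ->
  exists2 H : nat -> borel_baire -> borel_baire,
    forall n, measurable_fun setT (H n) &
    forall x y, A (join x y) -> exists n, y = H n x.
Proof.
move=> cA; have /existsNP[H /not_implyP[mH noH]] : ~ good [:: [::]].
  by move=> /uncountable_section[x]; apply.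
exists H => // x y /AK[p Kp]; apply: contrapT => noy; apply: noH.
exists x, (fun=> unslice (fun k => nth x [:: x; y; p] k)); split => j.
  case: j => // _; split; rewrite /wit ?slice_unslice //.
move=> n _; rewrite slice_unslice /= => E; apply: noy; exists n; exact: E.
Qed.

End lusin_novikov.

Theorem lusin_novikov (A : set borel_baire) : measurable A ->
  (forall x, countable [set y | A (join x y)]) ->
  exists2 H : nat -> borel_baire -> borel_baire,
    forall n, measurable_fun setT (H n) &
    forall x y, A (join x y) -> exists n, y = H n x.
Proof.
move=> /measurable_analytic [K cK AK].
exact: lusin_novikov_closed cK AK.
Qed.

(** * Standard Borel spaces and the Feldman-Moore theorem *)

Lemma half_expr_small (R : realType) (eps : R) :
  (0 < eps)%R -> exists k, (2^-1 ^+ k < eps)%R.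
Proof.
move=> e0; exists (Num.bound eps^-1).
have := archi_boundP (ltW (etrans (invr_gt0 eps) e0)).
set n := Num.bound _ => en.
rewrite exprVn -[ltRHS]invrK ltf_pV2 ?posrE ?invr_gt0 ?exprn_gt0 //.
by rewrite (lt_trans en) // -natrX ltr_nat ltn_expl.
Qed.

(** * Coding a Polish space in Baire space *)

Section polish_coding.
Variables (R : realType) (M : metricType R).
Local Open Scope ring_scope.

Let q k : R := 2^-1 ^+ k.

Let q_gt0 k : 0 < q k. Proof. by rewrite exprn_gt0 // invr_gt0. Qed.

Let qS k : q k = 2 * q k.+1.
Proof. by rewrite /q exprS mulrA divff ?mul1r. Qed.

Let q_small (eps : R) : 0 < eps -> exists k, q k < eps.
Proof. exact: half_expr_small. Qed.

Let ballE (x y : M) (r : R) : ball x r y = (mdist x y < r).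
Proof. by rewrite ballEmdist. Qed.

Lemma metric_ball_open (x : M) (r : R) : open (ball x r).
Proof.
rewrite openE => y; rewrite ballE => xy; apply/nbhs_ballP.
exists (r - mdist x y); first by rewrite /= subr_gt0.
by move=> z; have := metric_triangle x y z; rewrite !ballE; lra.
Qed.

Lemma metric_ball_eq (x y : M) : (forall e : R, 0 < e -> ball x e y) -> x = y.
Proof.
move=> xy; apply: mdist_positivity; apply: contrapT => /eqP N.
have := xy (mdist x y); rewrite lt_neqAle eq_sym N mdist_ge0 => /(_ isT).
by rewrite ballE ltxx.
Qed.

Variable e : nat -> M.
Hypothesis e_dense : forall O : set M, O !=set0 -> open O -> exists n, O (e n).
Hypothesis M_complete : complete_metric M.

Let code (y : M) : baire := fun k => least (fun i => `[< ball (e i) (q k) y >]).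

Let codeP y k : ball (e (code y k)) (q k) y.
Proof.
have [|i yi] := e_dense (O := ball y (q k)) _ (metric_ball_open _ _).
  by exists y; exact: ballxx.
have iy : `[< ball (e i) (q k) y >] by apply/asboolP; exact: ball_sym.
by have [/asboolP] := @leastP (fun i => `[< ball (e i) (q k) y >]) i iy.
Qed.

(* Steps that are too long are skipped, so that every [z] gives a Cauchy
   sequence. *)
Fixpoint guarded (z : baire) k : nat :=
  if k is k'.+1 then
    let i := guarded z k' in
    if `[< ball (e i) (2 * q k') (e (z k)) >] then z k else i
  else z 0%N.

Let u z k := e (guarded z k).

Let u_step z k : ball (u z k) (2 * q k) (u z k.+1).
Proof.
rewrite /u /=; case: asboolP => // _; apply: ballxx.
by rewrite mulr_gt0.
Qed.

Let u_ball z n k : ball (u z k) (4 * q k) (u z (k + n)).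
Proof.
elim: n k => [|n ih] k; first by rewrite addn0; apply: ballxx; rewrite mulr_gt0.
(* The constant [4] sums the geometric series of the step bounds [2 * q k]. *)
have -> : 4 * q k = 2 * q k + 4 * q k.+1 by rewrite [q k in RHS]qS [in LHS]qS; ring.
by apply: ball_triangle (u_step z k) _; rewrite addnS -addSn.
Qed.

Let u_cvg z : exists x : M, u z @ \oo --> x.
Proof.
apply: M_complete; apply: cauchy_exP => eps e0.
have [k kP] := q_small (divr_gt0 e0 (ltr0n _ 4)).
exists (u z k), k => // n /= kn; rewrite -(subnKC kn).
apply: le_ball (u_ball z (n - k) k); rewrite mulrC -ler_pdivlMr //.
exact: ltW.
Qed.

Let decode z : M := projT1 (cid (u_cvg z)).

Let decode_ball z k : ball (u z k) (5 * q k) (decode z).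
Proof.
rewrite /decode; case: cid => x /= ux.
have [N _ NP] := cvg_ball ux (q_gt0 k).
have := NP (maxn N k) (leq_maxl _ _) => /ball_sym xu.
(* The fifth [q k] is the distance from a late term to the limit. *)
have -> : 5 * q k = 4 * q k + q k by ring.
apply: ball_triangle xu; rewrite -(subnKC (leq_maxr N k)); exact: u_ball.
Qed.

(** Successive terms of a code are within [q k + q k.+1 < 2 * q k] of each other, so nothing is
    skipped. *)
Let code_guarded y k : guarded (code y) k = code y k.
Proof.
elim: k => //= k ->; case: asboolP => // -[].
have H1 := codeP y k; have /ball_sym H2 := codeP y k.+1.
apply: le_ball (ball_triangle H1 H2); have := q_gt0 k.+1; have := qS k; lra.
Qed.

Let codeK : cancel code decode.
Proof.
move=> y; apply: metric_ball_eq => eps e0.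
have [k kP] := q_small (divr_gt0 e0 (ltr0n _ 6)).
have /ball_sym H1 := decode_ball (code y) k.
have H2 := codeP y k; rewrite /u code_guarded in H1.
by apply: le_ball (ball_triangle H1 H2); lra.
Qed.

Let guarded_meas k : dmeasurable (fun z : borel_baire => guarded z k).
Proof.
elim: k => [|k ih] /=; first exact: dmeasurable_coord.
exact: (dmeasurable2 (fun i j =>
  if `[< ball (e i) (2 * q k) (e j) >] then j else i) ih (dmeasurable_coord _)).
Qed.

Let decode_meas (O : set M) : open O ->
  measurable (decode @^-1` O : set borel_baire).
Proof.
(* Any factor of at least [5] puts [decode z] into the ball; with [8], the ball lies within
   [13 * q k] of [decode z]. *)
move=> oO; rewrite (_ : _ @^-1` _ = \bigcup_k
    ((fun z => guarded z k) @^-1` [set i | ball (e i) (8 * q k) `<=` O])).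
  apply: bigcupT_measurable => k; apply: dmeasurable_preimage.
  exact: guarded_meas.
apply/seteqP; split => z /=.
  move: oO; rewrite openE => /[apply] /nbhs_ballP[eps /= e0 eO].
  have [k kP] := q_small (divr_gt0 e0 (ltr0n _ 13)).
  exists k => // x /= ux; apply: eO; have /ball_sym uz := decode_ball z k.
  by apply: le_ball (ball_triangle uz ux); lra.
move=> [k _ /= kO]; apply: kO; apply: le_ball (decode_ball z k).
by rewrite ler_pM2r // ler_nat.
Qed.

(** An injection with a Borel left inverse suffices to transfer the Lusin-Novikov theorem; no Borel
    isomorphism is needed. *)
Lemma polish_coding : exists (c : M -> baire) (r : baire -> M),
  [/\ cancel c r,
    forall d (Y : measurableType d) (f : Y -> M),
      (forall O : set M, open O -> measurable (f @^-1` O)) ->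
      measurable_fun setT (c \o f : Y -> borel_baire) &
    forall O : set M, open O -> measurable (r @^-1` O : set borel_baire)].
Proof.
exists code, decode; split=> [|d Y f mf|]; [exact: codeK| |exact: decode_meas].
apply/measurable_baireP => k; apply: dmeasurable_least => i.
apply: dmeasurable_bool; rewrite (_ : [set _ | _] = f @^-1` ball (e i) (q k)).
  exact/mf/metric_ball_open.
by apply/seteqP; split => y /= /asboolP.
Qed.

End polish_coding.

Lemma standard_borel_coding (R : realType) d (Y : measurableType d) :
  standard_borel R Y ->
  exists (c : Y -> borel_baire) (r : borel_baire -> Y),
    [/\ measurable_fun setT c, measurable_fun setT r & cancel c r].
Proof.
move=> [M [f [[D cD dD] cM [g fg gf] fE]]].
have [e e_dense] : exists e : nat -> M,
    forall O : set M, O !=set0 -> open O -> exists n, O (e n).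
  have /countable_injP[h h_inj] := cD.
  exists (fun n => xget (f point) [set x | D x /\ h x = n]) => O O0 oO.
  have [x [Ox Dx]] := dD O O0 oO; exists (h x).
  case: xgetP => [y _ [Dy hy]|/(_ x)[]//].
  by rewrite (h_inj y x) // inE.
have [c [r [rc mc mr]]] := polish_coding e_dense cM.
exists (c \o f), (g \o r); split.
- apply: mc => O oO; apply/fE; rewrite image_preimage.
    exact: sub_sigma_algebra.
  by apply/seteqP; split => // x _; exists (g x).
- move=> _ A /fE fA; rewrite setTI.
  have -> : (g \o r) @^-1` A = r @^-1` (f @` A).
    apply/seteqP; split => z /=; first by exists (g (r z)).
    by move=> [y Ay <-]; rewrite fg.
  suff : <<s [set B : set M | open B] >> `<=`
      [set B : set M | measurable (r @^-1` B : set borel_baire)] by exact.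
  apply: smallest_sub; last exact: mr.
  split=> [|B mB|F mF] /=; first by rewrite preimage_set0; exact: measurable0.
    by rewrite setTD preimage_setC; exact: measurableC.
  by rewrite preimage_bigcup; exact: bigcupT_measurable.
- by move=> y /=; rewrite rc fg.
Qed.

(** * Generating a countable Borel equivalence relation by Borel involutions *)

Section feldman_moore.
Context (R : realType) d (Y : measurableType d) (F : Y -> Y -> Prop).
Hypothesis cF : countable_borel_equivalence R F.

Let F_refl x : F x x.
Proof. by have [/(_ x)] := cbe_equivalence cF. Qed.

Let F_sym x y : F x y -> F y x.
Proof. by have [_ /(_ x y)] := cbe_equivalence cF. Qed.

Variables (c : Y -> borel_baire) (r : borel_baire -> Y).
Hypothesis c_meas : measurable_fun setT c.
Hypothesis r_meas : measurable_fun setT r.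
Hypothesis cK : cancel c r.

Definition separator i y :=
  if unpickle i is Some (n, k) then c y n == k else false.

Lemma separator_meas i : dmeasurable (separator i).
Proof.
rewrite /separator; case: unpickle => [[n k]|]; last exact: dmeasurable_cst.
have /measurable_baireP mc := c_meas.
exact: (dmeasurable_comp (fun m => m == k) (mc n)).
Qed.

Lemma separatorP x y : x <> y -> exists i, separator i x && ~~ separator i y.
Proof.
move=> xy; have [n xn] : exists n, c x n <> c y n.
  apply: contrapT => no; apply: xy; rewrite -(cK x) -(cK y); congr r.
  by apply/funext => n; apply: contrapT => ?; apply: no; exists n.
exists (pickle (n, c x n)); rewrite /separator pickleK eqxx /=.
by apply/eqP => E; apply: xn.
Qed.

Let measurable_F d' (T : measurableType d') (f g : T -> Y) :
  measurable_fun setT f -> measurable_fun setT g ->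
  measurable [set t | F (f t) (g t)].
Proof.
move=> mf mg; have := measurable_fun_pair mf mg.
by move=> /(_ measurableT _ (cbe_borel cF)); rewrite setTI.
Qed.

Lemma measurable_fun_if_dmeasurable (p : Y -> bool) (f g : Y -> Y) :
  dmeasurable p -> measurable_fun setT f -> measurable_fun setT g ->
  measurable_fun setT (fun y => if p y then f y else g y).
Proof.
move=> mp; apply: measurable_fun_ifT; apply: (measurable_fun_bool true).
by rewrite setTI; exact: mp.
Qed.

Lemma countable_functions : exists g : nat -> Y -> Y,
  [/\ forall n, measurable_fun setT (g n), forall n y, F y (g n y) &
    forall y z, F y z -> exists n, z = g n y].
Proof.
(* The second clause restricts second coordinates to codes of points; without it the sections could
   be uncountable, as [r] need not be injective. *)
pose A : set borel_baire := [set u | F (r (slice 0 u)) (r (slice 1 u)) /\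
  c (r (slice 1 u)) = slice 1 u].
have mA : measurable A.
  apply: measurableI.
    by apply: measurable_F; exact: (measurableT_comp r_meas (measurable_slice _)).
  apply: measurable_baire_eq; last exact: measurable_slice.
  exact: (measurableT_comp c_meas (measurableT_comp r_meas (measurable_slice _))).
have [x|H mH HP] := lusin_novikov mA.
  apply: (@sub_countable _ _ _ (c @` [set y | F (r x) y])).
    apply: subset_card_le => y [/=]; rewrite slice0_join slice1_join => Fy cy.
    by exists (r y).
  exact: card_le_trans (card_image_le _ _) (cbe_countable cF _).
pose h n y := r (H n (c y)).
have mh n : measurable_fun setT (h n).
  exact: (measurableT_comp r_meas (measurableT_comp (mH n) c_meas)).
exists (fun n y => if `[< F y (h n y) >] then h n y else y); split.
- move=> n; apply: measurable_fun_if_dmeasurable => //.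
  apply: dmeasurable_bool; rewrite (_ : [set _ | _] = [set y | F y (h n y)]).
    by apply: measurable_F => //; exact: measurable_id.
  by apply/seteqP; split => y /= /asboolP.
- by move=> n y; case: asboolP.
- move=> y z Fyz; have [|n cz] := HP (c y) (c z).
    by rewrite /A /= slice0_join slice1_join !cK.
  by exists n; rewrite /h -cz cK asboolT.
Qed.

(** Where [g m] undoes [g n] and [g n] leads out of the separating set [i], points and images are
    disjoint, so exchanging them is an involution. The triples [(n, m, i)] account for all related
    pairs of distinct points. *)
Lemma feldman_moore : exists theta : nat -> Y -> Y,
  [/\ forall n, involutive (theta n), forall n, measurable_fun setT (theta n),
    forall n y, F y (theta n y) &
    forall y z, F y z -> y = z \/ exists n, z = theta n y].
Proof.
have [g [mg Fg gF]] := countable_functions.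
pose good n m y := ~~ `[< g m (g n y) <> y >].
have good_meas n m : dmeasurable (good n m).
  apply: (dmeasurable_comp negb).
  apply: (dmeasurable_neq separator_meas separatorP).
  exact: (measurableT_comp (mg m) (mg n)).
pose dom n m i y := separator i y && ~~ separator i (g n y) && good n m y.
pose dom' n m i y := ~~ separator i y && separator i (g m y) && good m n y.
pose th n m i y := if dom n m i y then g n y else
  if dom' n m i y then g m y else y.
have goodE n m y : good n m y -> g m (g n y) = y.
  by move=> /asboolPn/contrapT.
have thK n m i : involutive (th n m i).
  move=> y; rewrite {2}/th; case: (boolP (dom n m i y)) => [|nD].
    move=> /andP[/andP[sy sgy] gd]; have E := goodE _ _ _ gd.
    rewrite /th /dom (negbTE sgy) /= /dom' sgy E sy /= /good E.
    by case: asboolP.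
  case: (boolP (dom' n m i y)) => [|nD']; last first.
    by rewrite /th (negbTE nD) (negbTE nD').
  move=> /andP[/andP[sy sgy] gd]; have E := goodE _ _ _ gd.
  rewrite /th /dom sgy E sy /= /good E.
  by case: asboolP.
exists (fun j => if unpickle j is Some (n, m, i) then th n m i else id).
split=> [j|j|j y|y z Fyz].
- by case: unpickle => [[[n m] i]|] y; first exact: thK.
- case: unpickle => [[[n m] i]|]; last exact: measurable_id.
  apply: measurable_fun_if_dmeasurable => //.
    apply: (dmeasurable3 (fun a b c => a && ~~ b && c)) => //.
      exact: separator_meas.
    exact: (dmeasurable_precomp (mg n) (separator_meas i)).
  apply: measurable_fun_if_dmeasurable => //.
  apply: (dmeasurable3 (fun a b c => ~~ a && b && c)) => //.
    exact: separator_meas.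
  exact: (dmeasurable_precomp (mg m) (separator_meas i)).
- case: unpickle => [[[n m] i]|//]; rewrite /th.
  by case: ifP => // _; case: ifP.
- have [|yz] := pselect (y = z); [by left|right].
  have [n zE] := gF _ _ Fyz; have [m yE] := gF _ _ (F_sym Fyz).
  have [i /andP[sy sz]] := separatorP yz.
  exists (pickle (n, m, i)); rewrite pickleK /th /dom -zE sy sz /= /good -zE -yE.
  by case: asboolP.
Qed.

End feldman_moore.

(** * The space of ternary sequences *)

Lemma open_three_omegaP (O : set three_omega) :
  open O <-> forall x, O x -> exists n, forall y : nat -> 'I_3, agree n y x -> O y.
Proof.
split=> [oO x Ox|HO].
  apply: contrapT => /forallNP no.
  have /choice[y yP] n : exists y : nat -> 'I_3, agree n y x /\ ~ O y.
    by have /existsNP[y /not_implyP[? ?]] := no n; exists y.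
  have yx : {ptws, (y : nat -> three_omega) @ \oo -->
      (x : nat -> discrete_topology 'I_3)}.
    apply/pointwise_cvgP => t.
    rewrite discrete_cvg.
    exists t.+1 => // n /= tn.
    by have [+ _] := yP n; apply.
  have [|n _ nO] := yx O.
    by apply: open_nbhs_nbhs; split.
  by have [_] := yP n; apply; exact: (nO n (leqnn n)).
have cyl n (x : nat -> 'I_3) : open [set y : three_omega | agree n y x].
  elim: n => [|n ih].
    rewrite (_ : [set _ | _] = setT); first exact: openT.
    by apply/seteqP; split.
  rewrite (_ : [set _ | _] = [set y : three_omega | agree n y x] `&`
      (@proj nat (fun=> discrete_topology 'I_3) n @^-1` [set x n])).
    apply: openI => //; apply: open_comp; last exact: discrete_open.
    by move=> y _; exact: proj_continuous.
  apply/seteqP; split => y.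
    move=> yx; split; last exact: yx.
    exact: agree_leq (leqnSn n) yx.
  by move=> [yx yn] i; rewrite ltnS leq_eqVlt => /orP[/eqP ->//|]; exact: yx.
have [N NP] : {N : three_omega -> nat | forall x, O x ->
    forall y : nat -> 'I_3, agree (N x) y x -> O y}.
  have ex x : exists n, O x -> forall y : nat -> 'I_3, agree n y x -> O y.
    by have [/HO[n nP]|no] := pselect (O x); [exists n|exists 0].
  by have [N NP] := choice ex; exists N.
rewrite (_ : O = \bigcup_(x in O) [set y : three_omega | agree (N x) y x]).
  by apply: bigcup_open => x _; exact: cyl.
apply/seteqP; split => y; first by move=> Oy; exists y.
by move=> [x Ox yx]; exact: NP yx.
Qed.

(** * A complete separable metric on ternary sequences *)

Section three_omega_polish.
Variable R : realType.
Local Open Scope ring_scope.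

Let diff (x y : three_omega) := least (fun n => x n != y n).

Let diffP (x y : three_omega) n : agree n x y <-> x = y \/ (n <= diff x y)%N.
Proof.
split=> [xy|[->|nd] i ni] //; last first.
  apply: contrapT => /eqP xyi.
  have [_ /(_ i)] := @leastP (fun n => x n != y n) i xyi.
  by rewrite xyi => /(_ (leq_trans ni nd)).
have [->|/eqP nxy] := eqVneq x y; [by left|right].
have [k xyk] : exists k, x k != y k.
  apply: contrapT => no; apply: nxy; apply/funext => k.
  by apply/eqP; apply: contrapT => /negP xyk; apply: no; exists k.
have [dxy _] := @leastP (fun n => x n != y n) k xyk.
by rewrite leqNgt; apply/negP => /xy E; rewrite /diff E eqxx in dxy.
Qed.

Let dist (x y : three_omega) : R := if x == y then 0 else 2^-1 ^+ diff x y.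

Let half_gt0 n : 0 < 2^-1 ^+ n :> R.
Proof. by rewrite exprn_gt0 // invr_gt0. Qed.

Let half_le m n : (2^-1 ^+ m <= 2^-1 ^+ n :> R) = (n <= m)%N.
Proof. by rewrite ler_iXn2l ?invr_gt0 ?invf_lt1 ?ltr1n. Qed.

Let dist_agree x y n : dist x y <= 2^-1 ^+ n <-> agree n x y.
Proof.
rewrite diffP /dist; case: eqP => [->|xy].
  by split=> _; [left|exact/ltW/half_gt0].
by rewrite half_le; split=> [|[]//]; right.
Qed.

Let distxx x : dist x x = 0.
Proof. by rewrite /dist eqxx. Qed.

Let dist_pos x y : dist x y = 0 -> x = y.
Proof.
by rewrite /dist; case: eqP => // _ E; have := half_gt0 (diff x y); rewrite E ltxx.
Qed.

Let dist_ge0 x y : 0 <= dist x y.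
Proof. by rewrite /dist; case: eqP => // _; exact/ltW/half_gt0. Qed.

Let dist_sym x y : dist x y = dist y x.
Proof.
rewrite /dist eq_sym; case: eqP => // _; congr (_ ^+ _).
by rewrite /diff; congr least; apply/funext => n; rewrite eq_sym.
Qed.

Let dist_triangle y x z : dist x z <= dist x y + dist y z.
Proof.
(* The stronger ultrametric inequality holds. *)
suff [H|H] : dist x z <= dist x y \/ dist x z <= dist y z.
- by apply: le_trans H _; rewrite lerDl.
- by apply: le_trans H _; rewrite lerDr.
have [->|/eqP xy] := eqVneq x y; first by right.
have [<-|/eqP yz] := eqVneq y z; first by left.
have xyE : dist x y = 2^-1 ^+ diff x y by rewrite /dist; case: eqP.
have yzE : dist y z = 2^-1 ^+ diff y z by rewrite /dist; case: eqP.
have Hxy : agree (diff x y) x y by apply/diffP; right.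
have Hyz : agree (diff y z) y z by apply/diffP; right.
case: (leqP (diff x y) (diff y z)) => [le|/ltnW le]; [left|right].
  rewrite xyE; apply/dist_agree; apply: agree_trans Hxy _.
  exact: agree_leq le Hyz.
rewrite yzE; apply/dist_agree; apply: agree_trans _ Hyz.
exact: agree_leq le Hxy.
Qed.

(** A copy of the space carries the topology of the metric; both topologies are compared through the
    same description of open sets by [agree]. *)
Definition three_metric : Type := three_omega.
HB.instance Definition _ := Choice.on three_metric.
HB.instance Definition _ := isMetric.Build R three_metric
  distxx dist_pos dist_sym dist_triangle.

Let ball_dist (x y : three_metric) (r : R) : ball x r y = (dist x y < r).
Proof. by rewrite ballEmdist. Qed.

Let open_three_metricP (O : set three_metric) :
  open O <-> forall x, O x -> exists n, forall y : nat -> 'I_3, agree n y x -> O y.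
Proof.
rewrite openE; split=> [oO x /oO /nbhs_ballP[r /= r0 rO]|HO x /HO[n nO]].
  have [n nr] := half_expr_small r0; exists n => y /agree_sym xy; apply: rO.
  rewrite ball_dist; apply: le_lt_trans nr; exact/dist_agree.
apply/nbhs_ballP; exists (2^-1 ^+ n); first exact: half_gt0.
move=> y; rewrite ball_dist => /ltW/dist_agree/agree_sym; exact: nO.
Qed.

Lemma standard_borel_three_omega : standard_borel R borel_three_omega.
Proof.
exists three_metric, id; split.
- exists (range (fun s : seq 'I_3 => (fun n => nth ord0 s n) : three_metric)).
    exact: card_le_trans (card_image_le _ _) (countableP _).
  move=> O [x Ox] /open_three_metricP/(_ x Ox)[n nO].
  exists (fun i => nth ord0 (mkseq x n) i); split; last by exists (mkseq x n).
  by apply: nO => i ni; rewrite nth_mkseq.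
- move=> u uC.
  have near_u n : exists N, forall k l, (N <= k)%N -> (N <= l)%N ->
      agree n (u k) (u l).
    have [N [x xN]] : exists N x, forall k, (N <= k)%N -> ball x (2^-1 ^+ n) (u k).
      have [x [N _ Nx]] := (cauchyP _).1 uC _ (half_gt0 n).
      by exists N, x => k; exact: Nx.
    exists N => k l Nk Nl.
    have uk := xN k Nk; have ul := xN l Nl; rewrite !ball_dist in uk ul.
    apply: (@agree_trans _ _ _ x); first apply: agree_sym.
      exact/dist_agree/ltW/uk.
    exact/dist_agree/ltW/ul.
  have /choice[N NP] := near_u.
  (* Coordinate [i] is read at a stage from which the first [i + 1] coordinates no longer change. *)
  pose x : three_metric := fun i => u (N i.+1) i.
  exists x; apply/cvg_ballP => eps e0; have [n ne] := half_expr_small e0.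
  exists (\max_(i < n.+1) N i)%N => // k /= nk.
  rewrite ball_dist; apply: le_lt_trans ne; apply/dist_agree => i ni.
  rewrite /x; apply: (NP i.+1) => //.
  exact: leq_trans (leq_bigmax (Ordinal (ni : (i.+1 < n.+1)%N))) nk.
- by exists id.
- move=> A; rewrite image_id.
  suff -> : @open three_metric = @open three_omega by [].
  apply/funext => O; apply/propext.
  by rewrite open_three_metricP open_three_omegaP.
Qed.

End three_omega_polish.

(** * Universality *)

Lemma computable_permutations : exists g h : nat -> nat -> nat,
  [/\ forall n, cancel (g n) (h n), forall n, cancel (h n) (g n),
    forall n, computable (g n) &
    forall p p', computable p -> cancel p p' -> cancel p' p ->
      exists n, g n = p /\ h n = p'].
Proof.
have /countable_injP[e e_inj] := computable_countable.
pose perm g := computable g /\ exists h, cancel g h /\ cancel h g.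
(* Numbers that code no computable permutation yield the identity. *)
pose g n := xget (id : nat -> nat) [set p | perm p /\ e p = n].
have gP n : perm (g n).
  rewrite /g; case: xgetP => [p _ []//|_].
  by split; [exact: computable_id|exists id].
have /choice[h hP] n : exists h, cancel (g n) h /\ cancel h (g n).
  by have [] := gP n.
exists g, h; split=> [n|n|n|p p' rp pp' p'p]; try by have [] := hP n.
  by have [] := gP n.
have gE : g (e p) = p.
  rewrite /g; case: xgetP => [p1 _ [[rp1 _] E]|/(_ p)[]].
    by apply: e_inj; rewrite ?inE.
  by split=> //; split=> //; exists p'.
exists (e p); split => //; apply/funext => x.
have [_ hK] := hP (e p).
by rewrite -[LHS]pp' -{1}gE hK.
Qed.

Section recursive_isomorphism.
Variable T : Type.
Implicit Types x y z : nat -> T.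

Lemma recursively_isomorphic_equivalence :
  RelationClasses.Equivalence (@recursively_isomorphic T).
Proof.
split=> [x|x y [g [h [rg gh hg xy]]]|x y z [g [h [rg gh hg xy]]]
    [g' [h' [rg' gh' hg' yz]]]].
- by exists id, id; split => //; exact: computable_id.
- exists h, g; split => //; first exact: computable_inv rg gh hg.
  by move=> n; rewrite xy gh.
- exists (g' \o g), (h \o h'); split => //.
  + exact: computable_comp.
  + exact: can_comp.
  + exact: can_comp.
  + by move=> n; rewrite yz xy.
Qed.

Lemma recursively_isomorphic_countable x :
  countable [set y | recursively_isomorphic x y].
Proof.
apply: (@sub_countable _ _ _ ((fun h => x \o h) @` [set h | computable h])).
  apply: subset_card_le => y [g [h [rg gh hg xy]]]; exists h.
    exact: computable_inv rg gh hg.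
  by apply/funext => n; rewrite xy.
exact: card_le_trans (card_image_le _ _) computable_countable.
Qed.

End recursive_isomorphism.

Lemma dmeasurable_three_omega n :
  dmeasurable (fun x : borel_three_omega => (x : nat -> 'I_3) n).
Proof.
move=> a; apply: sub_sigma_algebra; apply/open_three_omegaP => x /= xa.
by exists n.+1 => y; rewrite -xa; apply.
Qed.

(** An open set is the union of the cylinders it contains, which are indexed by the countably many
    finite sequences. *)
Lemma measurable_three_omega d (Y : measurableType d) (f : Y -> nat -> 'I_3) :
  (forall n, dmeasurable (fun y => f y n)) ->
  measurable_fun setT (f : Y -> borel_three_omega).
Proof.
move=> mf; apply: (@measurability _ _ _ borel_three_omega setT f
  (@open three_omega : set (set borel_three_omega))) => //.
move=> _ [U /open_three_omegaP oU <-]; rewrite setTI.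
pose cyl (s : seq 'I_3) y := agree (size s) (f y) (nth ord0 s).
have mcyl s : measurable (cyl s).
  have -> : cyl s = \bigcap_i (if i < size s
      then [set y | f y i = nth ord0 s i] else setT).
    apply/seteqP; split => [y ys i _|y ys i si].
      by case: ifP => // si; exact: ys.
    by have := ys i Logic.I; rewrite si.
  apply: bigcapT_measurable => i; case: ifP => _; last exact: measurableT.
  exact: mf.
have -> : f @^-1` U = \bigcup_(s in [set s | cyl s `<=` f @^-1` U]) cyl s.
  apply/seteqP; split => [y Uy|y [s sU] /sU//].
  have [n nU] := oU _ Uy; have yn : cyl (mkseq (f y) n) y.
    by move=> i; rewrite size_mkseq => ni; rewrite nth_mkseq.
  exists (mkseq (f y) n) => // z; rewrite /cyl size_mkseq => zn.
  by apply: nU => i ni; rewrite zn // nth_mkseq.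
rewrite bigcup_mkcond; apply: countable_bigcupT_measurable => [|s].
  exact: countableP.
by case: ifP => _; [exact: mcyl|exact: measurable0].
Qed.

Lemma recursively_isomorphic_measurable :
  measurable [set p : borel_three_omega * borel_three_omega |
    recursively_isomorphic p.1 p.2].
Proof.
have [g [h [gh hg rg ghP]]] := computable_permutations.
rewrite (_ : [set _ | _] = \bigcup_n \bigcap_k
    ((fun p : borel_three_omega * borel_three_omega =>
      (p.2 : nat -> 'I_3) k == (p.1 : nat -> 'I_3) (h n k)) @^-1` [set true])).
  apply: bigcupT_measurable => n; apply: bigcapT_measurable => k.
  apply: (dmeasurable2 eq_op).
    exact: (dmeasurable_precomp measurable_snd (dmeasurable_three_omega k)).
  exact: (dmeasurable_precomp measurable_fst (dmeasurable_three_omega (h n k))).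
apply/seteqP; split => -[x y] /=.
  move=> [p [p' [rp pp' p'p xy]]]; have [n [_ hE]] := ghP _ _ rp pp' p'p.
  by exists n => // k _ /=; rewrite hE xy eqxx.
move=> [n _ xy]; exists (g n), (h n); split => // k.
by apply/eqP; exact: (xy k Logic.I).
Qed.

Lemma countable_borel_recursive_isomorphism (R : realType) :
  countable_borel_equivalence R
    (fun x y : borel_three_omega => recursively_isomorphic x y).
Proof.
split.
- exact: standard_borel_three_omega.
- exact: recursively_isomorphic_equivalence.
- exact: recursively_isomorphic_measurable.
- exact: recursively_isomorphic_countable.
Qed.

(** * Words act by Borel automorphisms inside the classes *)

Section word_action.
Context d (Y : measurableType d) (theta : nat -> Y -> Y).
Hypothesis thetaK : forall n, involutive (theta n).
Hypothesis theta_meas : forall n, measurable_fun setT (theta n).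

Lemma word_ind (P : nat -> Prop) : P 0 -> (forall n, P (wcons n 0)) ->
  (forall n w, 0 < w -> P w -> P (wcons n w)) -> forall x, P x.
Proof.
move=> P0 P1 PS; elim/ltn_ind => x ih; case: (posnP x) => [->//|x0].
rewrite (wcons_letter_rest x0); case: (posnP (rest x)) => [->|r0]; first exact: P1.
by apply: PS => //; apply: ih; exact: ltn_rest.
Qed.

Lemma act_automorphism x : exists b : Y -> Y,
  [/\ cancel (act theta x) b, cancel b (act theta x),
    measurable_fun setT (act theta x) & measurable_fun setT b].
Proof.
have idP (f : Y -> Y) : f =1 id -> exists b : Y -> Y,
    [/\ cancel f b, cancel b f, measurable_fun setT f & measurable_fun setT b].
  by move=> /funext ->; exists id; split => //; exact: measurable_id.
elim/word_ind: x => [|n|n w w0 [b [ab ba ma mb]]].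
- exact: idP.
- by apply: idP => y; exact: act_wcons0.
have -> : act theta (wcons n w) = act theta w \o theta n.
  by apply/funext => y; exact: act_wcons.
exists (theta n \o b); split.
- by move=> y /=; rewrite ab thetaK.
- by move=> y /=; rewrite thetaK ba.
- exact: measurableT_comp.
- exact: measurableT_comp.
Qed.

Lemma act_related (F : Y -> Y -> Prop) : RelationClasses.Equivalence F ->
  (forall n y, F y (theta n y)) -> forall x y, F y (act theta x y).
Proof.
move=> [refl _ trans] Ft; elim/word_ind => [y|n y|n w w0 ih y].
- exact: refl.
- by rewrite act_wcons0.
- by rewrite act_wcons //; exact: trans (Ft n y) (ih _).
Qed.

End word_action.

Theorem theorem1p7 (R : realType) :
  universal_countable_borel_equivalence R
    (fun x y : borel_three_omega => recursively_isomorphic x y).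
Proof.
split; first exact: countable_borel_recursive_isomorphism.
move=> d Y F cF.
have Feq := cbe_equivalence cF; have [F_refl F_sym F_trans] := Feq.
have [c [r [mc mr cr]]] := standard_borel_coding (cbe_standard cF).
have [theta [thetaK mtheta Ftheta thetaF]] := feldman_moore cF mc mr cr.
have [g [h [gh hg rg ghP]]] := computable_permutations.
have /choice[A' A'P] := act_automorphism thetaK mtheta.
(* [e j] is a position of column [j] at which the identity acts: a one-letter word, or the empty
   word for [j = 0]. *)
pose e j := if j is j'.+1 then wcons j' 0 else 0.
have [col [mcol col0 colP]] : exists col : nat -> Y -> 'I_3,
    [/\ forall j, dmeasurable (col j), col 0 = cst ord0 &
    forall n y y', (forall x, coded (act theta) column col y' x =
        coded (act theta) column col y (g n x)) ->
      exists x, y' = act theta x y \/ y = act theta x y'].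
  apply: (diagonal_columns (separator_meas mc) (separatorP cr)
    (A' := A') (e := e) _ _ _ _ _ _ gh hg).
  - by move=> x; have [] := A'P x.
  - by move=> x; have [] := A'P x.
  - by move=> x; have [] := A'P x.
  - by move=> x; have [] := A'P x.
  - by move=> [|j] y //; exact: act_wcons0.
  - by move=> [|j] //; exact: column_wcons0.
pose f y : nat -> 'I_3 := coded (act theta) column col y.
exists f.
  apply: measurable_three_omega => n.
  have [_ _ ma _] := A'P n.
  exact: (dmeasurable_precomp ma (mcol _)).
move=> y z; split=> [Fyz|[p [p' [rp pp' p'p yz]]]].
  have [->|[n ->]] := thetaF _ _ Fyz.
    by have [refl _ _] := recursively_isomorphic_equivalence 'I_3; exact: refl.
  exists (toggle n), (toggle n).
  split; [exact: computable_toggle|exact: toggleK|exact: toggleK|].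
  move=> x; rewrite /f /coded column_toggle.
  (* The toggle fixes position [0] instead of acting there; the constant column [0] makes this
     harmless. *)
  case: (posnP x) => [->|x0]; first by rewrite col0.
  by rewrite act_toggle.
(* The code of [z] is that of [y] composed with the inverse [p'], so [p'] is the permutation to look
   up. *)
have rp' := computable_inv rp pp' p'p.
have [n [gn _]] := ghP _ _ rp' p'p pp'.
have [|x [->|->]] := colP n y z.
- by move=> x; rewrite gn; exact: yz.
- exact: act_related.
- by apply: F_sym; exact: act_related.
Qed.
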